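(* There are exactly eleven incongruent unfoldings of the cube; that is, the set of all unfoldings of the cube has exactly eleven equivalence classes under congruence in the plane.
   Context: Let $\mathcal{C}\subset\mathbb{R}^3$ be the surface of a cube, with its six square faces. A finite collection of squares in the plane (all congruent to the faces of $\mathcal{C}$) is said to be joined along edges if any two distinct squares of the collection are disjoint, or meet in a single common corner, or meet precisely in a full edge of both squares. Such a collection is called connected if any two of its squares are linked by a chain of squares of the collection in which consecutive squares share an edge, and the boundary (in the plane) of the union of the squares has a single connected component. An unfolding of the cube is a connected planar arrangement $U$ of six squares, joined along edges, which folds up into the cube: there is a continuous map $f$ from the union of the squares onto $\mathcal{C}$ that restricts to an isometry of each square of $U$ onto a face of $\mathcal{C}$, with the six squares going to the six distinct faces. Two unfoldings are congruent if some isometry of the plane (orientation-preserving or orientation-reversing) carries one to the other; otherwise they are incongruent. *)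

(* Defs.v *)
From HB Require Import structures.
From mathcomp Require Import all_boot all_order all_algebra.
From mathcomp Require Import all_classical all_reals all_analysis.
Import Order.TTheory GRing.Theory Num.Theory.
Import numFieldNormedType.Exports.
Set Implicit Arguments.
Unset Strict Implicit.
Unset Printing Implicit Defensive.
Local Open Scope classical_set_scope.
Local Open Scope ring_scope.

Section Euclidean.
Variable R : realType.

(* The library norm on row vectors is the sup norm: it induces the right
   topology, but not the right isometries. *)
Definition eucl_dist n (x y : 'rV[R]_n) : R :=
  Num.sqrt (\sum_(i < n) (x ord0 i - y ord0 i) ^+ 2).

Definition isometric_on n m (A : set 'rV[R]_n) (f : 'rV[R]_n -> 'rV[R]_m) :=
  forall x y, A x -> A y -> eucl_dist (f x) (f y) = eucl_dist x y.

(* Surjectivity is automatic for a distance-preserving self-map of R^n;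
   orientation-reversing maps are included. *)
Definition euclidean_isometry n (f : 'rV[R]_n -> 'rV[R]_n) :=
  isometric_on setT f.

Definition boundary n (A : set 'rV[R]_n) : set 'rV[R]_n :=
  closure A `\` interior A.

Definition components n (A : set 'rV[R]_n) : set (set 'rV[R]_n) :=
  [set connected_component A x | x in A].

(* For n = 2: a square, its four sides and its four corners;
   for n = 3: a solid cube and its six faces. *)
Definition box n (a : R) : set 'rV[R]_n :=
  [set x | forall i, 0 <= x ord0 i <= a].
Arguments box n a _ : clear implicits.

Definition facet n (a : R) (i : 'I_n) (b : bool) : set 'rV[R]_n :=
  [set x | box n a x /\ x ord0 i = if b then a else 0].

Definition box_corner n (a : R) : set 'rV[R]_n :=
  [set x | forall i, x ord0 i = 0 \/ x ord0 i = a].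

End Euclidean.
Arguments box {R} n a _.
Arguments facet {R} n a i b _.
Arguments box_corner {R} n a _.

Section Arrangements.
Variable R : realType.
Local Notation plane := 'rV[R]_2.
Implicit Types (a : R) (S T E : set plane) (U V : set (set plane)).

Definition is_square a S :=
  exists2 g : plane -> plane, euclidean_isometry g & S = g @` box 2 a.

Definition corner_of a S (p : plane) :=
  exists g : plane -> plane,
    [/\ euclidean_isometry g, S = g @` box 2 a & (g @` box_corner 2 a) p].

Definition edge_of a S E :=
  exists g : plane -> plane,
    [/\ euclidean_isometry g, S = g @` box 2 a &
        exists i b, E = g @` facet 2 a i b].

Definition share_edge a S T := edge_of a S (S `&` T) /\ edge_of a T (S `&` T).

Definition share_corner a S T :=
  exists p, [/\ S `&` T = [set p], corner_of a S p & corner_of a T p].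

Definition joined_along_edges a U :=
  forall S T, U S -> U T -> S <> T ->
    [\/ S `&` T = set0, share_corner a S T | share_edge a S T].

Definition squares_union U : set plane := \bigcup_(S in U) S.

Definition edge_chain a U S T :=
  exists s : seq (set plane),
    [/\ forall Q, Q \in S :: s -> U Q,
        path (fun P Q => `[< share_edge a P Q >]) S s & last S s = T].

Definition connected_arrangement a U :=
  (forall S T, U S -> U T -> edge_chain a U S T) /\
  (components (boundary (squares_union U)) #= `I_1)%card.

Definition congruent U V :=
  exists2 g : plane -> plane, euclidean_isometry g & V = [set g @` S | S in U].

End Arrangements.

Section Unfoldings.
Variable R : realType.
Local Notation plane := 'rV[R]_2.
Local Notation space := 'rV[R]_3.

(* The cube has side a and is placed in space by the isometry h. *)
Variables (a : R) (h : space -> space).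

Definition cube_faces : set (set space) :=
  [set F | exists i b, F = h @` facet 3 a i b].

Definition cube_surface : set space := \bigcup_(F in cube_faces) F.

Definition folding (U : set (set plane)) (f : plane -> space) :=
  [/\ {within squares_union U, continuous f},
      f @` squares_union U = cube_surface,
      forall S, U S -> isometric_on S f &
      set_bij U cube_faces (fun S => f @` S)].

Definition unfolding (U : set (set plane)) :=
  [/\ (U #= `I_6)%card,
      forall S, U S -> is_square a S,
      joined_along_edges a U,
      connected_arrangement a U &
      exists f, folding U f].

Definition unfolding_classes : set (set (set (set plane))) :=
  [set [set V | unfolding V /\ congruent U V] | U in unfolding].

End Unfoldings.

(* Main.v *)
From mathcomp Require Import all_boot all_order all_algebra finmap.
From mathcomp Require Import all_classical all_reals all_analysis.
From mathcomp Require Import ring lra zify.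
Require Import Defs.
Import Order.TTheory GRing.Theory Num.Theory.
Import numFieldNormedType.Exports.
Set Implicit Arguments.
Unset Strict Implicit.
Unset Printing Implicit Defensive.
Local Open Scope classical_set_scope.
Local Open Scope ring_scope.

(** Tile the plane by translates of one square of an arrangement.  A square
    that shares an edge with a square of this tiling belongs to the tiling,
    because an isometry that preserves an edge of a square either preserves the
    square or carries it across that edge ([share_edge_neighbor]).  An
    edge-connected arrangement of six congruent squares is therefore, up to an
    isometry of the plane, a hexomino.

    The folding map is affine on every square and sends it onto a face of the
    cube, so on that square it is given by a frame: the cube vertex below the
    lower left corner and the two axes along which the sides of the square run
    ([facet_frame]).  Two adjacent squares agree along their common edge and
    cover different faces, which leaves one possibility: passing to the
    neighbor rolls the cube over the common edge ([roll_unique]).  The frame of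
    one square thus determines all the others, and whether a polyomino folds
    onto distinct faces becomes a finite computation ([foldable]).

    Foldable polyominoes are enumerated by adding one square at a time and
    keeping one copy up to lattice symmetry ([level]).  Inside an unfolding
    such a copy can always be enlarged until the six squares are exhausted
    ([level_copy]), and the enumeration ends with the eleven nets
    ([nets_complete]).

    Conversely each of the eleven nets is an unfolding ([net_unfolding]).  Its
    folding map is glued from the affine maps of the squares, which agree on
    overlaps since they agree at the common lattice points
    ([fold_map_agree]).  Its boundary is the union of the intersections of a
    square of the net with a lattice square outside the net
    ([boundary_region]); these convex pieces are finite in number and are
    linked to each other through common lattice points, so their union is
    connected ([boundary_connected]).

    Finally an isometry of the plane that maps one lattice square onto another
    is a lattice symmetry ([isometry_cell]), so congruence of two nets is again
    a finite question, and no two of the eleven nets are congruent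
    ([nets_distinct]). *)

(** * Lattice squares and their symmetries *)

Notation cell_index := (int * int)%type.

(** The coordinates are exchanged first if [swap] holds, then negated as
    prescribed by [flipx] and [flipy], and [shift] is added last. *)
Record lattice_sym := LatticeSym {
  swap : bool; flipx : bool; flipy : bool; shift : cell_index }.

Definition sym_lin (d : bool * bool * bool) (c : cell_index) : cell_index :=
  let: (sw, fx, fy) := d in
  let: p := if sw then (c.2, c.1) else c in
  (if fx then - p.1 else p.1, if fy then - p.2 else p.2).

Definition sym_cell (s : lattice_sym) (c : cell_index) : cell_index :=
  let d := sym_lin (swap s, flipx s, flipy s) c in
  ((shift s).1 + d.1, (shift s).2 + d.2).

Definition neighbors (c : cell_index) : seq cell_index :=
  [:: (c.1 + 1, c.2); (c.1 - 1, c.2); (c.1, c.2 + 1); (c.1, c.2 - 1)].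

(** Finite types are enumerated by explicit lists, here and for the axes of the
    cube, so that the finite checks below reduce to a truth value. *)
Definition bools := [:: false; true].

Definition bools2 := [seq (e, f) | e <- bools, f <- bools].
Definition bools3 := [seq (p, g) | p <- bools2, g <- bools].

(** The symmetry with linear part [d] that sends the cell [h] to [c]. *)
Definition align (h : cell_index) (p : bool * bool * bool * cell_index) :=
  let: (d, c) := p in
  let h' := sym_lin d h in
  LatticeSym d.1.1 d.1.2 d.2 (c.1 - h'.1, c.2 - h'.2).

(** A symmetry carrying [t] into [s] is determined by its linear part and by
    the image of the head of [t], so finitely many candidates suffice. *)
Definition embeds (t s : seq cell_index) : bool :=
  has (fun p => all (fun c => sym_cell (align (head (0, 0) t) p) c \in s) t)
    [seq (d, c) | d <- bools3, c <- s].

(** The last cell is the oldest one; every other cell is attached to an older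
    one.  This order is what both the rolling of the cube and the connectedness
    of the arrangement follow. *)
Fixpoint grown (s : seq cell_index) : bool :=
  if s is c :: s' then
    nilp s' || (has (fun x => c \in neighbors x) s' && grown s')
  else true.

(** * Rolling the cube along a polyomino *)

Definition ax0 : 'I_3 := @Ordinal 3 0 isT.
Definition ax1 : 'I_3 := @Ordinal 3 1 isT.
Definition ax2 : 'I_3 := @Ordinal 3 2 isT.
Definition axes := [:: ax0; ax1; ax2].

(** The remaining axis when [i] and [j] are distinct. *)
Definition third (i j : 'I_3) : 'I_3 :=
  match (i + j)%N with 1 => ax2 | 2 => ax1 | _ => ax0 end.

(** Bit [k] tells on which of the two facets orthogonal to axis [k] the vertex
    lies. *)
Definition cube_vertex := (bool * bool * bool)%type.

Definition bit (v : cube_vertex) (k : 'I_3) : bool :=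
  match val k with 0 => v.1.1 | 1 => v.1.2 | _ => v.2 end.

Definition toggle (k : 'I_3) (v : cube_vertex) : cube_vertex :=
  match val k with
  | 0 => (~~ v.1.1, v.1.2, v.2)
  | 1 => (v.1.1, ~~ v.1.2, v.2)
  | _ => (v.1.1, v.1.2, ~~ v.2)
  end.

(** A frame [(v, i, j)] places a square on the cube: its lower left corner goes
    to [v], its horizontal side runs along axis [i] and its vertical side along
    axis [j]. *)
Definition frame := (cube_vertex * 'I_3 * 'I_3)%type.

Definition frame_face (f : frame) : 'I_3 * bool :=
  let: (v, i, j) := f in (third i j, bit v (third i j)).

Definition frame_corner (f : frame) (d : bool * bool) : cube_vertex :=
  let: (v, i, j) := f in
  let v' := if d.1 then toggle i v else v in
  if d.2 then toggle j v' else v'.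

(** A direction is a pair of booleans: the first one distinguishes vertical from
    horizontal moves, the second one forward from backward moves. *)
Definition step (d : bool * bool) (c : cell_index) : cell_index :=
  match d with
  | (false, true) => (c.1 + 1, c.2)
  | (false, false) => (c.1 - 1, c.2)
  | (true, true) => (c.1, c.2 + 1)
  | (true, false) => (c.1, c.2 - 1)
  end.

(** Rolling the cube over an edge keeps the axis along that edge and exchanges
    the other axis of the face with the axis [k] orthogonal to it.  After a
    forward move the new lower left corner is the other end of a side of the
    old face; after a backward move it is the neighbor of the old corner along
    [k]. *)
Definition roll (d : bool * bool) (f : frame) : frame :=
  let: (v, i, j) := f in
  let k := third i j in
  let v' := toggle (if d.2 then if d.1 then j else i else k) v in
  if d.1 then (v', i, k) else (v', k, j).

(** All the neighbors of [c] present in [t] yield the same frame whenever [t]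
    comes from a folding map ([fold_frames_eq]), so the first one is taken. *)
Definition roll_onto (f0 : frame) (t : seq (cell_index * frame)) c : frame :=
  head f0 [seq roll p.2 p.1.2 |
    p <- [seq (x, d) | x <- t, d <- bools2] & step p.2 p.1.1 == c].

Fixpoint fold_frames (f0 : frame) (s : seq cell_index) :=
  if s is c :: s' then
    let t := fold_frames f0 s' in (c, roll_onto f0 t c) :: t
  else [::].

Definition all_frames : seq frame :=
  [seq (v, ij.1, ij.2) | v <- bools3,
     ij <- [seq ij <- [seq (i, j) | i <- axes, j <- axes] | ij.1 != ij.2]].

(** The answer does not depend on the frame of the first square, by symmetry of
    the cube; trying all 48 frames dispenses with this argument. *)
Definition foldable (s : seq cell_index) : bool :=
  has (fun f0 => uniq [seq frame_face x.2 | x <- fold_frames f0 s]) all_frames.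

(** * Enumeration of the foldable polyominoes *)

Definition extensions (s : seq cell_index) : seq (seq cell_index) :=
  [seq c :: s | c <- flatten [seq neighbors x | x <- s] & c \notin s].

Definition add_new (s : seq cell_index) (acc : seq (seq cell_index)) :=
  if has (fun t => embeds t s) acc then acc else s :: acc.

Definition next_level (L : seq (seq cell_index)) : seq (seq cell_index) :=
  foldr add_new [::] [seq s <- flatten [seq extensions s | s <- L] | foldable s].

Definition level (n : nat) := iter n next_level [:: [:: (0, 0)]].

Definition row4 : seq cell_index := [:: (3, 0); (2, 0); (1, 0); (0, 0)].
Definition row3 : seq cell_index := [:: (2, 0); (1, 0); (0, 0)].

(** The first six nets have a row of four squares with one square above and one
    below; the next three have a row of three, a row of two that starts above
    its right end, and one square below; the last two are made of two rows of
    three overlapping in one column and of three rows of two forming a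
    staircase.  Every list is ordered so that it is [grown]. *)
Definition nets : seq (seq cell_index) :=
  [seq [:: (ij.1, 1), (ij.2, -1) & row4]
     | ij <- [:: (0, 0); (0, 1); (0, 2); (0, 3); (1, 1); (1, 2)]] ++
  [seq [:: (i, -1), (3, 1), (2, 1) & row3] | i <- [:: 0; 1; 2]] ++
  [:: [:: (4, 1), (3, 1), (2, 1) & row3];
      [:: (3, 2); (2, 2); (2, 1); (1, 1); (1, 0); (0, 0)]].

Lemma embedsP t s : embeds t s -> exists f, {in t, forall c, sym_cell f c \in s}.
Proof. by case/hasP => p _ /allP; exists (align (head (0, 0) t) p). Qed.

Lemma embeds_intro f t s : t != [::] ->
  {in t, forall c, sym_cell f c \in s} -> embeds t s.
Proof.
case: t => // h t _ ts; apply/hasP.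
exists (swap f, flipx f, flipy f, sym_cell f h).
  apply/allpairsP; exists (swap f, flipx f, flipy f, sym_cell f h).
  split=> //=; last by apply: ts; rewrite mem_head.
  by case: (swap f) (flipx f) (flipy f) => [] [] [].
apply/allP => c /ts; rewrite /sym_cell.
by case: f {ts} => sw fx fy [t1 t2] /=; rewrite !addrK.
Qed.

Lemma embeds_refl s : s != [::] -> embeds s s.
Proof.
move=> s0; apply: (embeds_intro (f := LatticeSym false false false (0, 0))) => //.
by move=> [x y] xs; rewrite /sym_cell /= !add0r.
Qed.

Lemma dedup_complete (L : seq (seq cell_index)) s : s \in L -> s != [::] ->
  exists2 t, t \in foldr add_new [::] L & embeds t s.
Proof.
elim: L => //= s' L IH; rewrite inE => /orP[/eqP->|sL] s0; last first.
  have [t tL ts] := IH sL s0; exists t => //.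
  by rewrite /add_new; case: ifP => // _; rewrite inE tL orbT.
rewrite /add_new; case: ifP => [/hasP[t tL ts]|_]; first by exists t.
by exists s'; [rewrite mem_head|exact: embeds_refl].
Qed.

Lemma dedup_sub (L : seq (seq cell_index)) :
  {subset foldr add_new [::] L <= L}.
Proof.
elim: L => //= s L IH t; rewrite /add_new; case: ifP => _; rewrite !inE.
  by move=> /IH ->; rewrite orbT.
by case/orP => [->//|/IH->]; rewrite orbT.
Qed.

(** The step of the enumeration: attaching a square to a listed polyomino gives,
    up to symmetry, a listed polyomino of the next level. *)
Lemma next_level_complete L s c x : s \in L -> x \in s -> c \in neighbors x ->
  c \notin s -> foldable (c :: s) ->
  exists2 t, t \in next_level L & embeds t (c :: s).
Proof.
move=> sL xs cx cs fcs; apply: dedup_complete => //.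
rewrite mem_filter fcs; apply/flattenP; exists (extensions s).
  exact: map_f.
apply: map_f; rewrite mem_filter cs; apply/flattenP.
by exists (neighbors x) => //; exact: map_f.
Qed.

Lemma next_level_sound L t : t \in next_level L ->
  exists s c x, [/\ s \in L, t = c :: s, x \in s, c \in neighbors x & c \notin s].
Proof.
move/dedup_sub; rewrite mem_filter => /andP[_] /flattenP[e /mapP[s sL ->]].
case/mapP=> c; rewrite mem_filter => /andP[cs /flattenP[_ /mapP[x xs ->] cx]] ->.
by exists s, c, x.
Qed.

Lemma level_grown n s : s \in level n -> [/\ size s = n.+1, uniq s & grown s].
Proof.
elim: n s => [|n IH] s; first by rewrite inE => /eqP ->.
case/next_level_sound=> s' [c [x [/IH[ss us gs] -> xs cx cs]]].
rewrite /= ss cs us gs; split=> //; apply/orP; right.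
by rewrite andbT; apply/hasP; exists x.
Qed.

Lemma neighbors_step c x : c \in neighbors x ->
  exists2 d, d \in bools2 & c = step d x.
Proof.
rewrite !inE => /or4P[] /eqP->; [exists (false, true)|exists (false, false)|
  exists (true, true)|exists (true, false)] => //.
Qed.

(** Frames that follow the rolling rule between all adjacent squares are
    recovered by rolling from the frame of the oldest square. *)
Lemma fold_frames_eq (phi : cell_index -> frame) s : grown s ->
  (forall d c, c \in s -> step d c \in s -> phi (step d c) = roll d (phi c)) ->
  fold_frames (phi (last (0, 0) s)) s = [seq (c, phi c) | c <- s].
Proof.
elim: s => //= c s IH gs rs.
case: s IH gs rs => [|c' s'] //; set s := c' :: s' => IH gs rs.
rewrite [last c s](_ : _ = last (0, 0) s) //.
have {gs} [hs gs] : has (fun x => c \in neighbors x) s /\ grown s.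
  by case/orP: gs => // /andP[].
clearbody s.
have rs' d x : x \in s -> step d x \in s -> phi (step d x) = roll d (phi x).
  by move=> xs ds; apply: rs; rewrite inE ?xs ?ds orbT.
rewrite (IH gs rs'); congr (_ :: _); congr pair.
rewrite /roll_onto; set l := [seq p <- _ | _].
have lP p : p \in l -> roll p.2 p.1.2 = phi c.
  rewrite mem_filter => /andP[/eqP pc /allpairsP[[x d] /= [/mapP[y ys ->] _ pE]]].
  rewrite pE /= in pc *; rewrite -pc rs ?pc ?mem_head //.
  by rewrite inE ys orbT.
have [x xs /neighbors_step[d db cE]] := hasP hs.
have : ((x, phi x), d) \in l.
  rewrite mem_filter; apply/andP; split; first by rewrite -cE.
  apply/allpairsP; exists ((x, phi x), d).
  by split=> //; apply/mapP; exists x.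
by case: l lP => // p l lP _ /=; apply: lP; rewrite mem_head.
Qed.

Lemma foldable_intro (phi : cell_index -> frame) s : grown s ->
  phi (last (0, 0) s) \in all_frames -> uniq s ->
  (forall d c, c \in s -> step d c \in s -> phi (step d c) = roll d (phi c)) ->
  {in s &, injective (frame_face \o phi)} -> foldable s.
Proof.
move=> gs fl us rs inj; apply/hasP; exists (phi (last (0, 0) s)) => //.
by rewrite fold_frames_eq // -map_comp map_inj_in_uniq.
Qed.

(** The two corners of a square, in local coordinates, on its side facing
    direction [d]. *)
Definition side (d : bool * bool) (y : bool) : bool * bool :=
  if d.1 then (y, d.2) else (d.2, y).

Lemma roll_check : all (fun f => all (fun f' => all (fun d =>
  [==> all (fun y => frame_corner f (side d y) ==
                     frame_corner f' (side (d.1, ~~ d.2) y)) bools,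
       frame_face f != frame_face f' => f' == roll d f]) bools2)
  all_frames) all_frames.
Proof. by vm_compute. Qed.

Lemma mem_bools2 d : d \in bools2.
Proof. by case: d => [] [] []. Qed.

(** Two frames that agree on the common edge of adjacent squares share the axis
    along that edge; the other axis is then free only between lying in the same
    face, which is excluded, and rolling. *)
Lemma roll_unique f f' d : f \in all_frames -> f' \in all_frames ->
  (forall y, frame_corner f (side d y) = frame_corner f' (side (d.1, ~~ d.2) y)) ->
  frame_face f != frame_face f' -> f' = roll d f.
Proof.
move=> fa fa' h ff; have /allP/(_ f fa)/allP/(_ f' fa')/allP := roll_check.
move=> /(_ d (mem_bools2 d)) /implyP; rewrite ff implyTb => /(_ _) /eqP; apply.
by apply/allP => y _; rewrite h.
Qed.

Lemma nets_complete s : s \in level 5 -> exists2 t, t \in nets & embeds t s.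
Proof.
have /allP : all (fun s => has (fun t => embeds t s) nets) (level 5).
  by vm_compute.
by move=> h /h /hasP.
Qed.

Lemma nets_distinct : {in nets &, forall s t, embeds s t -> s = t}.
Proof.
have /allrelP h : allrel (fun s t => embeds s t ==> (s == t)) nets nets.
  by vm_compute.
by move=> s t sn tn st; apply/eqP; have := h _ _ sn tn; rewrite st.
Qed.

(** * Finite conditions for a polyomino to be an unfolding *)

Definition corner (c : cell_index) (e : bool * bool) : cell_index :=
  (c.1 + e.1%:R, c.2 + e.2%:R).

(** The frames send every common corner of the two squares to the same vertex of
    the cube. *)
Definition agree (p q : cell_index * frame) : bool :=
  all (fun e => all (fun e' => (corner p.1 e == corner q.1 e') ==>
    (frame_corner p.2 e == frame_corner q.2 e')) bools2) bools2.

Definition net_frames := fold_frames (false, false, false, ax0, ax1).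

Definition folds_up (s : seq cell_index) : bool :=
  let t := net_frames s in
  [&& all (fun p => p.2.1.2 != p.2.2) t, allrel agree t t,
      uniq [seq frame_face p.2 | p <- t] &
      all (fun k => all (fun b =>
        (k, b) \in [seq frame_face p.2 | p <- t]) bools) axes].

Definition block (c : cell_index) : seq cell_index :=
  [seq (c.1 + x, c.2 + y) | x <- [:: -1; 0; 1], y <- [:: -1; 0; 1]].

(** A pair stands for the intersection of its two squares, one inside and one
    outside the polyomino.  Squares that do not touch the inner one contribute
    nothing, hence the restriction to its 3 x 3 block. *)
Definition boundary_pieces (s : seq cell_index) :=
  [seq p <- [seq (c, c') | c <- s, c' <- block c] | p.2 \notin s].

Definition incident (v c : cell_index) : bool :=
  (c.1 <= v.1 <= c.1 + 1) && (c.2 <= v.2 <= c.2 + 1).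

(** Four lattice squares with a common point have a common lattice point, so
    testing the corners of one of them is enough. *)
Definition meets (p q : cell_index * cell_index) : bool :=
  has (fun e => let v := corner p.1 e in
    [&& incident v p.1, incident v p.2, incident v q.1 & incident v q.2]) bools2.

(** Breadth-first search: [acc] absorbs at each round the pieces that meet it,
    and the search succeeds when no piece is left over. *)
Fixpoint linked (n : nat) (acc todo : seq (cell_index * cell_index)) : bool :=
  if n is n'.+1 then
    let near := [seq p <- todo | has (meets p) acc] in
    let far := [seq p <- todo | ~~ has (meets p) acc] in
    linked n' (near ++ acc) far
  else nilp todo.

Definition boundary_linked (s : seq cell_index) : bool :=
  if boundary_pieces s is p :: todo then
    meets p p && linked (size todo) [:: p] todo
  else false.

Lemma nets_realizable t : t \in nets ->
  [/\ size t = 6%N, uniq t, grown t, folds_up t & boundary_linked t].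
Proof.
have /allP : all (fun s =>
  [&& size s == 6%N, uniq s, grown s, folds_up s & boundary_linked s]) nets.
  by vm_compute.
by move=> h /h /and5P[/eqP].
Qed.

Lemma sym_cell_neighbor s c c' :
  c' \in neighbors c -> sym_cell s c' \in neighbors (sym_cell s c).
Proof.
case: s c c' => sw fx fy [t1 t2] [x y] [x' y'].
rewrite /neighbors /sym_cell !inE !xpair_eqE /=.
by case: sw fx fy => [] [] [] /=; lia.
Qed.

Lemma corner_incident c e : incident (corner c e) c.
Proof. by case: e => [] [] []; rewrite /incident /corner /=; lia. Qed.

Lemma step_corner d c y :
  corner (step d c) (side (d.1, ~~ d.2) y) = corner c (side d y).
Proof.
case: d c => [] [] [] [x z]; rewrite /corner /side /step /=.
all: by case: y; congr pair; lia.
Qed.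

Lemma step_neq d c : step d c != c.
Proof. by case: d c => [] [] [] [x y]; rewrite /step xpair_eqE /=; lia. Qed.

(** * Euclidean isometries *)

Lemma image_cancel (T U : Type) (u : T -> U) (v : U -> T) (A : set T) :
  cancel u v -> v @` (u @` A) = A.
Proof.
move=> uK; rewrite image_comp; apply/seteqP; split.
  by move=> _ [x Ax <-] /=; rewrite uK.
by move=> x Ax; exists x => //=; rewrite uK.
Qed.

Lemma can_image_inj (T U : Type) (u : T -> U) (v : U -> T) :
  cancel u v -> injective (fun A : set T => u @` A).
Proof. by move=> uK A B AB; rewrite -(image_cancel A uK) AB image_cancel. Qed.

Section EuclideanIsometries.
Variable R : realType.

Definition dot n (x y : 'rV[R]_n) : R := (x *m y^T) 0 0.

Lemma dotE n (x y : 'rV[R]_n) : dot x y = \sum_i x 0 i * y 0 i.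
Proof. by rewrite /dot mxE; apply: eq_bigr => i _; rewrite mxE. Qed.

Lemma dotC n (x y : 'rV[R]_n) : dot x y = dot y x.
Proof. by rewrite !dotE; apply: eq_bigr => i _; rewrite mulrC. Qed.

Lemma dotBl n (x y z : 'rV[R]_n) : dot (x - y) z = dot x z - dot y z.
Proof. by rewrite /dot mulmxBl !mxE. Qed.

Lemma dotBr n (x y z : 'rV[R]_n) : dot z (x - y) = dot z x - dot z y.
Proof. by rewrite dotC dotBl !(dotC z). Qed.

Lemma dotZl n c (x y : 'rV[R]_n) : dot (c *: x) y = c * dot x y.
Proof. by rewrite /dot -scalemxAl mxE. Qed.

Lemma dotZr n c (x y : 'rV[R]_n) : dot x (c *: y) = c * dot x y.
Proof. by rewrite dotC dotZl dotC. Qed.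

Lemma dot_ge0 n (x : 'rV[R]_n) : 0 <= dot x x.
Proof. by rewrite dotE sumr_ge0 // => i _; rewrite -expr2 sqr_ge0. Qed.

Lemma dot_eq0 n (x : 'rV[R]_n) : dot x x = 0 -> x = 0.
Proof.
move/eqP; rewrite dotE psumr_eq0; last by move=> i _; rewrite -expr2 sqr_ge0.
move/allP => h; apply/rowP => i; rewrite mxE.
by have /= := h i (mem_index_enum i); rewrite mulf_eq0 orbb => /eqP.
Qed.

Lemma eucl_distE n (x y : 'rV[R]_n) :
  eucl_dist x y = Num.sqrt (dot (x - y) (x - y)).
Proof.
by rewrite /eucl_dist dotE; congr Num.sqrt; apply: eq_bigr => i _; rewrite !mxE.
Qed.

Lemma eucl_dist_eq n m (x y : 'rV[R]_n) (z t : 'rV[R]_m) :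
  eucl_dist x y = eucl_dist z t <->
  dot (x - y) (x - y) = dot (z - t) (z - t).
Proof.
rewrite !eucl_distE; split=> [/eqP|->//].
by rewrite eqr_sqrt ?dot_ge0 // => /eqP.
Qed.

(** By polarization [f - f 0] preserves the inner products of vectors of [A].
    The images of the [a e_i], divided by [a], form orthonormal rows of [M], and
    [g x = f x - f 0] has the same inner products with them as [x *m M].  Hence
    [|g x - x *m M|^2 = |x|^2 - 2 |x|^2 + |x|^2 = 0]. *)
Lemma isometric_affine n m (A : set 'rV[R]_n) (f : 'rV[R]_n -> 'rV[R]_m) a :
  0 < a -> isometric_on A f -> A 0 ->
  (forall i, A (a *: delta_mx 0 i)) ->
  exists b (M : 'M[R]_(n, m)),
    M *m M^T = 1%:M /\ forall x, A x -> f x = b + x *m M.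
Proof.
move=> a0 fA A0 Ae.
have [g gE] : exists g, forall x, g x = f x - f 0 by exists (fun x => f x - f 0).
have gdot x y : A x -> A y -> dot (g x) (g y) = dot x y.
  move=> Ax Ay.
  have /eucl_dist_eq := fA _ _ Ax Ay; have /eucl_dist_eq := fA _ _ Ax A0.
  have /eucl_dist_eq := fA _ _ Ay A0; rewrite !subr0 -!gE.
  have -> : f x - f y = g x - g y by rewrite !gE opprB addrA subrK.
  rewrite !(dotBl, dotBr) (dotC (g y) (g x)) (dotC y x); lra.
pose M := \matrix_(i < n) (a^-1 *: g (a *: delta_mx 0 i)).
have de x i : dot x (delta_mx 0 i) = x 0 i.
  rewrite dotE (bigD1 i) //= big1 ?mxE ?eqxx ?mulr1 ?addr0 // => j /negPf ji.
  by rewrite mxE ji andbF mulr0.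
have gM x : A x -> g x *m M^T = x.
  move=> Ax; apply/rowP => i.
  have -> : (g x *m M^T) 0 i = dot (g x) (row i M).
    by rewrite dotE mxE; apply: eq_bigr => j _; rewrite !mxE.
  rewrite rowK dotZr gdot // dotZr de mulrA mulVf ?mul1r //; exact: lt0r_neq0.
have MM : M *m M^T = 1%:M.
  apply/row_matrixP => i; rewrite row_mul rowK -scalemxAl gM // scalerA.
  by rewrite mulVf ?scale1r ?lt0r_neq0 // row1.
exists (f 0), M; split=> // x Ax.
apply/eqP; rewrite addrC -subr_eq -gE -subr_eq0; apply/eqP/dot_eq0.
have dM : dot (g x) (x *m M) = dot x x by rewrite /dot trmx_mul mulmxA gM.
have dMM : dot (x *m M) (x *m M) = dot x x.
  by rewrite /dot trmx_mul mulmxA -[x *m M *m M^T]mulmxA MM mulmx1.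
by rewrite !(dotBl, dotBr) (dotC (x *m M) (g x)) dM dMM gdot // !subrr.
Qed.

Lemma euclidean_isometry_inv n (g : 'rV[R]_n -> 'rV[R]_n) :
  euclidean_isometry g ->
  exists k, [/\ euclidean_isometry k, cancel g k & cancel k g].
Proof.
move=> gi.
have [b [M [MM gE]]] := isometric_affine ltr01 gi I (fun _ => I).
exists (fun y => (y - b) *m M^T).
have gk : cancel (fun y => (y - b) *m M^T) g.
  by move=> y; rewrite gE // -mulmxA (mulmx1C MM) mulmx1 addrC subrK.
split=> //; first by move=> x y _ _; rewrite -(gi _ _ I I) !gk.
by move=> x; rewrite gE // addrC addKr -mulmxA MM mulmx1.
Qed.

Lemma euclidean_isometry_comp n (g k : 'rV[R]_n -> 'rV[R]_n) :
  euclidean_isometry g -> euclidean_isometry k -> euclidean_isometry (g \o k).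
Proof. by move=> gi ki x y _ _ /=; rewrite gi // ki. Qed.

End EuclideanIsometries.

(** * Isometries preserving the lattice of squares *)

Section Lattice.
Variables (R : realType) (a : R).
Hypothesis a0 : 0 < a.
Local Notation plane := 'rV[R]_2.

Definition pt (s t : R) : plane := \row_i (if i == ord0 then s else t).
Local Notation px x := (x ord0 (ord0 : 'I_2)).
Local Notation py x := (x ord0 (ord_max : 'I_2)).

Lemma px_pt s t : px (pt s t) = s. Proof. by rewrite mxE. Qed.
Lemma py_pt s t : py (pt s t) = t. Proof. by rewrite mxE. Qed.
Definition ptE := (px_pt, py_pt).

Lemma forall_I2 (P : 'I_2 -> Prop) : (forall i, P i) <-> P ord0 /\ P ord_max.
Proof.
split=> [h|[h0 h1] i]; first by split.
have [->|->] // : i = ord0 \/ i = ord_max.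
by case: i => [[|[|//]] hi]; [left|right]; apply: val_inj.
Qed.

Lemma plane_eq (x y : plane) : px x = px y -> py x = py y -> x = y.
Proof. by move=> h0 h1; apply/rowP; apply/forall_I2; split. Qed.

Lemma sum_I2 (V : zmodType) (F : 'I_2 -> V) : \sum_i F i = F ord0 + F ord_max.
Proof.
by rewrite big_ord_recr big_ord1 /=; congr (F _ + _); apply: val_inj.
Qed.

Definition cell (c : cell_index) : set plane :=
  [set x | a * c.1%:~R <= px x <= a * (c.1 + 1)%:~R /\
           a * c.2%:~R <= py x <= a * (c.2 + 1)%:~R].

Lemma cell0 : cell (0, 0) = box 2 a.
Proof.
apply/seteqP; split=> x; rewrite /box /cell /= !(mulr0, add0r, mulr1).
  by move=> h; apply/forall_I2.
by move/forall_I2.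
Qed.

Definition mirror (b : bool) (s : R) := if b then a - s else s.

Definition sym_pt (s : lattice_sym) (x : plane) : plane :=
  pt (a * (shift s).1%:~R + mirror (flipx s) (if swap s then py x else px x))
     (a * (shift s).2%:~R + mirror (flipy s) (if swap s then px x else py x)).

Lemma sym_pt_isometry s : euclidean_isometry (sym_pt s).
Proof.
move=> x y _ _; apply/eucl_dist_eq; rewrite !dotE !sum_I2 !mxE /=.
case: s => sw fx fy t /=; rewrite /mirror.
by case: sw fx fy => [] [] []; ring.
Qed.

Lemma mirror_itv b (t n : int) (s : R) :
  (a * (t + if b then - n else n)%:~R <= a * t%:~R + mirror b s
     <= a * (t + (if b then - n else n) + 1)%:~R) =
  (a * n%:~R <= s <= a * (n + 1)%:~R).
Proof.
rewrite /mirror; case: b; rewrite !(intrD, rmorphN) /=; apply/andP/andP;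
  case=> h1 h2; split; lra.
Qed.

Lemma sym_pt_cell s c x : cell (sym_cell s c) (sym_pt s x) <-> cell c x.
Proof.
case: s c => sw fx fy t [c1 c2]; rewrite /cell /sym_cell /sym_pt /= !ptE.
by case: sw; rewrite /= !mirror_itv; split=> -[].
Qed.

Lemma isometry_image (g : plane -> plane) A B : euclidean_isometry g ->
  (forall x, A (g x) <-> B x) -> g @` B = A.
Proof.
move=> /euclidean_isometry_inv[k [_ gK kK]] h; apply/seteqP; split.
  by move=> _ [x Bx <-]; apply/h.
by move=> y Ay; exists (k y) => //; apply/h; rewrite kK.
Qed.

Lemma sym_pt_image s c : sym_pt s @` cell c = cell (sym_cell s c).
Proof.
apply: isometry_image; first exact: sym_pt_isometry.
by move=> x; exact: sym_pt_cell.
Qed.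

(** The four values spread over a range of length [a (|p| + |r|)]. *)
Lemma sum_abs_le1 (B p r : R) :
  (forall e d : bool, 0 <= B + (e%:R * a * p + d%:R * a * r) <= a) ->
  `|p| + `|r| <= 1.
Proof.
move=> h; rewrite -(ler_pM2l a0) mulr1.
have := h true true; have := h true false; have := h false true.
have := h false false; rewrite !mul1r !mul0r.
move=> /andP[? ?] /andP[? ?] /andP[? ?] /andP[? ?].
case: (ger0P p) => _; case: (ger0P r) => _; lra.
Qed.

Lemma offset_mirror (B p : R) : `|p| = 1 -> 0 <= B <= a -> 0 <= B + a * p <= a ->
  exists b, forall x, B + x * p = mirror b x.
Proof.
case: (ger0P p) => _ => [->|/eqP]; last rewrite eqr_oppLR => /eqP ->.
  by rewrite mulr1 => /andP[? ?] /andP[? ?]; exists false => x /=; lra.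
by rewrite mulrN1 => /andP[? ?] /andP[? ?]; exists true => x /=; lra.
Qed.

(** [P], [Q], [T], [S] stand for the absolute values of the entries of a 2 x 2
    matrix with unit rows.  The squares of the two column sums add up to
    [2 + 2 P T + 2 Q S], which is at most 2, so both products vanish. *)
Lemma unit_rows_on_axes (P Q T S : R) : 0 <= P -> 0 <= Q -> 0 <= T -> 0 <= S ->
  P ^+ 2 + Q ^+ 2 = 1 -> T ^+ 2 + S ^+ 2 = 1 -> P + T <= 1 -> Q + S <= 1 ->
  [/\ P = 0, Q = 1, T = 1 & S = 0] \/ [/\ P = 1, Q = 0, T = 0 & S = 1].
Proof.
move=> P0 Q0 T0 S0 PQ TS PT QS.
have := mulr_ge0 P0 T0; have := mulr_ge0 Q0 S0.
have : (P + T) ^+ 2 <= 1 by rewrite expr_le1 ?addr_ge0.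
have : (Q + S) ^+ 2 <= 1 by rewrite expr_le1 ?addr_ge0.
rewrite !sqrrD => h1 h2 h3 h4.
have unit (x y : R) : 0 <= y -> x = 0 -> x ^+ 2 + y ^+ 2 = 1 -> y = 1.
  by move=> y0 -> /eqP; rewrite expr0n add0r sqrp_eq1 // => /eqP.
have /eqP : P * T = 0 by lra.
rewrite mulf_eq0 => /orP[] /eqP z; [left|right].
  have Q1 := unit _ _ Q0 z PQ.
  have z' : S = 0 by lra.
  by split=> //; apply: (unit _ _ T0 z'); rewrite addrC.
have S1 := unit _ _ S0 z TS.
have z' : Q = 0 by lra.
by split=> //; apply: (unit _ _ P0 z'); rewrite addrC.
Qed.

(** A unit square with orthonormal sides that fits in a box of the same size
    fills it: the sides are parallel to the axes, and each coordinate is one of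
    the parameters, possibly reversed. *)
Lemma signed_permutation (B1 B2 p q r s : R) :
  p ^+ 2 + q ^+ 2 = 1 -> r ^+ 2 + s ^+ 2 = 1 ->
  (forall e d : bool, 0 <= B1 + (e%:R * a * p + d%:R * a * r) <= a) ->
  (forall e d : bool, 0 <= B2 + (e%:R * a * q + d%:R * a * s) <= a) ->
  exists sw b1 b2, forall x y,
    B1 + (x * p + y * r) = mirror b1 (if sw then y else x) /\
    B2 + (x * q + y * s) = mirror b2 (if sw then x else y).
Proof.
move=> pq rs h1 h2.
have sq (x : R) : `|x| ^+ 2 = x ^+ 2 by rewrite real_normK ?num_real.
have := @unit_rows_on_axes `|p| `|q| `|r| `|s|; rewrite !sq !normr_ge0.
move=> /(_ isT isT isT isT pq rs (sum_abs_le1 h1) (sum_abs_le1 h2)).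
move: (h1 false false) (h1 true false) (h1 false true).
move: (h2 false false) (h2 true false) (h2 false true).
rewrite !mul1r !mul0r !addr0 ?add0r => k1 k2 k3 k4 k5 k6.
move=> [] [].
  move=> /normr0_eq0 -> Q1 T1 /normr0_eq0 ->.
  have [b2 hb2] := offset_mirror Q1 k1 k2.
  have [b1 hb1] := offset_mirror T1 k4 k6.
  by exists true, b1, b2 => x y; rewrite !mulr0 addr0 add0r hb1 hb2.
move=> P1 /normr0_eq0 -> /normr0_eq0 -> S1.
have [b2 hb2] := offset_mirror S1 k1 k3.
have [b1 hb1] := offset_mirror P1 k4 k5.
by exists false, b1, b2 => x y; rewrite !mulr0 addr0 add0r hb1 hb2.
Qed.

Lemma corner_in_cell c (e d : bool) :
  cell c (pt (a * c.1%:~R + e%:R * a) (a * c.2%:~R + d%:R * a)).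
Proof.
have ? := a0; rewrite /cell /= !ptE !intrD !mulrDr.
by case: e d => [] []; rewrite /= ?mulr1n ?mulr0n ?mul1r ?mul0r; split;
  apply/andP; split; lra.
Qed.

(** The isometry is affine with an orthogonal linear part, and the images of the
    four corners of [cell c] lie in [cell c'], so [signed_permutation] applies
    to it in the local coordinates of the two cells. *)
Lemma isometry_cell (g : plane -> plane) c c' : euclidean_isometry g ->
  g @` cell c `<=` cell c' ->
  exists2 s, sym_cell s c = c' & forall x, g x = sym_pt s x.
Proof.
move=> gi gc; have [b [M [MM gE]]] := isometric_affine a0 gi I (fun _ => I).
have row0 i : M i ord0 ^+ 2 + M i ord_max ^+ 2 = 1.
  have := congr1 (fun A : 'M[R]_2 => A i i) MM.
  by rewrite mxE sum_I2 !mxE eqxx !expr2.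
have gx x : px (g x) = px b + (px x * M ord0 ord0 + py x * M ord_max ord0).
  by rewrite gE // !mxE sum_I2.
have gy x : py (g x) = py b + (px x * M ord0 ord_max + py x * M ord_max ord_max).
  by rewrite gE // !mxE sum_I2.
pose z := pt (a * c.1%:~R) (a * c.2%:~R).
pose B1 := px (g z) - a * c'.1%:~R; pose B2 := py (g z) - a * c'.2%:~R.
have corner (e d : bool) :
    0 <= B1 + (e%:R * a * M ord0 ord0 + d%:R * a * M ord_max ord0) <= a /\
    0 <= B2 + (e%:R * a * M ord0 ord_max + d%:R * a * M ord_max ord_max) <= a.
  have := gc _ (ex_intro2 _ _ _ (corner_in_cell c e d) erefl).
  rewrite /cell /= !gx !gy !ptE /B1 /B2 gx gy !ptE !intrD.
  by move=> [/andP[? ?] /andP[? ?]]; split; lra.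
have [sw [b1 [b2 sE]]] := signed_permutation (row0 _) (row0 _)
  (fun e d => (corner e d).1) (fun e d => (corner e d).2).
pose l := sym_lin (sw, b1, b2) c.
exists (LatticeSym sw b1 b2 (c'.1 - l.1, c'.2 - l.2)).
  by rewrite /sym_cell /= -/l !subrK; case: (c').
move=> x; have [h1 h2] := sE (px x - a * c.1%:~R) (py x - a * c.2%:~R).
apply: plane_eq; rewrite !ptE /=.
  transitivity (a * c'.1%:~R + mirror b1
    (if sw then py x - a * c.2%:~R else px x - a * c.1%:~R)).
    by rewrite -h1 /B1 !gx !ptE; ring.
  rewrite /l /sym_lin /mirror rmorphB /=.
  by case: (sw); case: (b1); rewrite /= ?rmorphN /=; ring.
transitivity (a * c'.2%:~R + mirror b2
  (if sw then px x - a * c.1%:~R else py x - a * c.2%:~R)).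
  by rewrite -h2 /B2 !gy !ptE; ring.
rewrite /l /sym_lin /mirror rmorphB /=.
by case: (sw); case: (b2); rewrite /= ?rmorphN /=; ring.
Qed.

End Lattice.

Section Edges.
Variables (R : realType) (a : R).
Hypothesis a0 : 0 < a.
Local Notation plane := 'rV[R]_2.
Local Notation px x := (x ord0 (ord0 : 'I_2)).
Local Notation py x := (x ord0 (ord_max : 'I_2)).

(** The four sides of the box are exchanged by symmetries of the box, so the
    isometry witnessing an edge can be chosen to bring the left side to it. *)
Lemma edge_of_left (S E : set plane) : edge_of a S E ->
  exists g, [/\ euclidean_isometry g, S = g @` box 2 a &
                E = g @` facet 2 a ord0 false].
Proof.
move=> [g [gi -> [i [b ->]]]].
suff [s [s0 s_left]] : exists s, sym_cell s (0, 0) = (0, 0) /\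
    forall x, (sym_pt a s x) ord0 i = (if b then a else 0) <-> px x = 0.
  have si : euclidean_isometry (sym_pt a s) by exact: sym_pt_isometry.
  have s_box x : box 2 a (sym_pt a s x) <-> box 2 a x.
    by rewrite -cell0; have := sym_pt_cell a s (0, 0) x; rewrite s0.
  exists (g \o sym_pt a s); split; first exact: euclidean_isometry_comp.
    by rewrite -image_comp (isometry_image si s_box).
  rewrite -image_comp; congr (g @` _); apply/esym/(isometry_image si) => x.
  by split=> -[/s_box bx /s_left hx].
move: i; apply/forall_I2; split.
  exists (LatticeSym false b false (0, 0)); split; first by case: (b).
  by move=> x; rewrite ptE /= mulr0 add0r /mirror; case: (b); split; lra.
exists (LatticeSym true false b (0, 0)); split; first by case: (b).
by move=> x; rewrite ptE /= mulr0 add0r /mirror; case: (b); split; lra.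
Qed.

(** The second row of the matrix is parallel to the left edge, so the first one
    is orthogonal to it: the square stays on the same side of the edge or is
    reflected across it. *)
Lemma left_edge_stabilizer (g : plane -> plane) : euclidean_isometry g ->
  g @` facet 2 a ord0 false = facet 2 a ord0 false ->
  g @` box 2 a = box 2 a \/ g @` box 2 a = cell a (-1, 0).
Proof.
move=> gi gf; have [b [M [MM gE]]] := isometric_affine a0 gi I (fun _ => I).
have edge_pt t : 0 <= t <= a -> facet 2 a ord0 false (g (pt 0 t)).
  move=> ta; rewrite -gf; exists (pt 0 t) => //; split; last by rewrite ptE.
  by apply/forall_I2; rewrite !ptE lexx ltW.
have [|/forall_I2] := edge_pt 0; first by rewrite lexx ltW.
rewrite !gE // !mxE !sum_I2 !ptE !mul0r !addr0 => -[_ B2] B1.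
have [|/forall_I2] := edge_pt a; first by rewrite lexx ltW.
rewrite !gE // !mxE !sum_I2 !ptE !mul0r !add0r B1 add0r => -[_ V2].
move/eqP; rewrite mulf_eq0 gt_eqF //= => /eqP V1.
have MMij i j : M i ord0 * M j ord0 + M i ord_max * M j ord_max = (i == j)%:R.
  have := congr1 (fun A : 'M[R]_2 => A i j) MM.
  by rewrite mxE sum_I2 !mxE.
have unit (x : R) : x * x = 1 -> `|x| = 1.
  move=> x1; apply/eqP; rewrite -(@sqrp_eq1 _ `|x|) // real_normK ?num_real //.
  by rewrite expr2 x1.
have v1 : `|M ord_max ord_max| = 1.
  by apply: unit; have := MMij ord_max ord_max; rewrite V1 mul0r add0r.
have u2 : M ord0 ord_max = 0.
  apply/eqP; have /eqP := MMij ord0 ord_max.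
  by rewrite V1 mulr0 add0r mulf_eq0 -(normr_eq0 (M ord_max _)) v1 oner_eq0 orbF.
have u1 : `|M ord0 ord0| = 1.
  by apply: unit; have := MMij ord0 ord0; rewrite u2 mul0r addr0.
have [f fE] := offset_mirror v1 B2 V2.
have gx x : g x = pt (px x * M ord0 ord0) (mirror a f (py x)).
  apply: plane_eq; rewrite ptE gE // !mxE sum_I2.
    by rewrite B1 V1 mulr0 addr0 add0r.
  by rewrite u2 mulr0 add0r fE.
move: u1; case: (ger0P (M ord0 ord0)) => _ u1.
  have gs : g = sym_pt a (LatticeSym false false f (0, 0)).
    by apply/funext => x; rewrite gx /sym_pt /= u1 mulr1 !mulr0 !add0r.
  by left; rewrite gs -cell0 sym_pt_image /sym_cell /= oppr0 if_same.
right; have {}u1 : M ord0 ord0 = -1 by lra.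
have gs : g = sym_pt a (LatticeSym false true f (-1, 0)).
  apply/funext => x; rewrite gx /sym_pt /= u1 mulrN1 mulr0 add0r.
  by congr pt; rewrite mulrN mulr1 addrA addNr add0r.
by rewrite gs -cell0 sym_pt_image /sym_cell /= oppr0 if_same.
Qed.

(** Both squares are images of the box by isometries [g1], [g2] taking the left
    edge to the common edge, so [left_edge_stabilizer] applies to the inverse
    of [g1] composed with [g2].  The square [T] is then the image by [g1] of
    the cell to the left of the box, and [g1] is [g] up to a lattice
    symmetry. *)
Lemma share_edge_neighbor (g : plane -> plane) c T :
  euclidean_isometry g -> share_edge a (g @` cell a c) T ->
  T <> g @` cell a c -> exists2 c', c' \in neighbors c & T = g @` cell a c'.
Proof.
move=> gi [/edge_of_left[g1 [g1i S1 E1]] /edge_of_left[g2 [g2i T2 E2]]] TS.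
have [k1 [k1i g1K k1K]] := euclidean_isometry_inv g1i.
have [k [ki gK kK]] := euclidean_isometry_inv gi.
have g2E (A : set plane) : g2 @` A = g1 @` ((k1 \o g2) @` A).
  by rewrite image_comp; congr image; apply/funext => x /=; rewrite k1K.
have := @left_edge_stabilizer (k1 \o g2) (euclidean_isometry_comp k1i g2i).
rewrite -image_comp -E2 E1 image_cancel // => /(_ erefl)[] gb.
  by case: TS; rewrite T2 g2E gb S1.
have kg1 : (k \o g1) @` cell a (0, 0) = cell a c.
  by rewrite -image_comp cell0 -S1 image_cancel.
have [|s sc sE] := isometry_cell a0 (euclidean_isometry_comp ki g1i)
  (c := (0, 0)) (c' := c); first by rewrite kg1.
exists (sym_cell s (-1, 0)).
  by rewrite -sc; apply: sym_cell_neighbor.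
rewrite T2 g2E gb -sym_pt_image image_comp; congr image.
by apply/funext => x /=; rewrite -sE /= kK.
Qed.

End Edges.

(** * Folding one square onto a face of the cube *)

Lemma forall_I3 (P : 'I_3 -> Prop) : P ax0 -> P ax1 -> P ax2 -> forall i, P i.
Proof.
move=> h0 h1 h2 i; have /or3P[/eqP->|/eqP->|/eqP->] // :
  [|| i == ax0, i == ax1 | i == ax2].
by case: i => [[|[|[|//]]] hi].
Qed.

Lemma sum_I3 (V : zmodType) (F : 'I_3 -> V) : \sum_i F i = F ax0 + F ax1 + F ax2.
Proof.
rewrite !big_ord_recr big_ord0 /= add0r.
by congr (F _ + F _ + F _); apply: val_inj.
Qed.

Section FoldMaps.
Variables (R : realType) (a : R).
Hypothesis a0 : 0 < a.
Local Notation plane := 'rV[R]_2.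
Local Notation space := 'rV[R]_3.
Local Notation px x := (x ord0 (ord0 : 'I_2)).
Local Notation py x := (x ord0 (ord_max : 'I_2)).

Definition lattice_pt (c : cell_index) : plane := pt (a * c.1%:~R) (a * c.2%:~R).

Definition vertex_pt (v : cube_vertex) : space :=
  \row_k (if bit v k then a else 0).

(** The isometry that places the square [c] on the cube [box 3 a] as prescribed
    by the frame. *)
Definition fold_map (c : cell_index) (f : frame) (x : plane) : space :=
  let: (v, i, j) := f in
  \row_k (if k == i then mirror a (bit v i) (px x - a * c.1%:~R)
          else if k == j then mirror a (bit v j) (py x - a * c.2%:~R)
          else if bit v k then a else 0).

Lemma lattice_pt_cell v c : incident v c -> cell a c (lattice_pt v).
Proof.
move=> /andP[/andP[h1 h2] /andP[h3 h4]].
by rewrite /cell /= !ptE !ler_pM2l // !ler_int h1 h2 h3 h4.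
Qed.

Lemma vertex_pt_inj : injective vertex_pt.
Proof.
move=> v w /rowP h.
have bE k : bit v k = bit w k.
  have := h k; rewrite !mxE; case: (bit v k); case: (bit w k) => // /eqP.
    by rewrite gt_eqF.
  by rewrite lt_eqF.
move: (bE ax0) (bE ax1) (bE ax2); rewrite /bit /=.
by case: v w {h bE} => [[? ?] ?] [[? ?] ?] /= -> -> ->.
Qed.

Lemma fold_map_corner c v i j e : i != j ->
  fold_map c (v, i, j) (lattice_pt (corner c e)) =
  vertex_pt (frame_corner (v, i, j) e).
Proof.
move=> ij; have ? := a0; apply/rowP => k; rewrite !mxE ?ptE !intrD.
case: v => [[v0 v1] v2]; move: i j k ij.
do 3 (apply: forall_I3); rewrite // /mirror /bit /toggle /=;
 case: e => [] [] []; rewrite /=; case: ifP => //= _; by [|lra].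
Qed.

Lemma fold_map_isometric c v i j A : i != j -> isometric_on A (fold_map c (v, i, j)).
Proof.
move=> ij x y _ _; apply/eucl_dist_eq; rewrite !dotE sum_I2 sum_I3 !mxE /mirror.
move: i j ij; do 2 (apply: forall_I3); rewrite // => _ /=;
  case: (bit _ _); case: (bit _ _); case: (bit _ _); ring.
Qed.

Lemma fold_map_image c v i j : i != j ->
  fold_map c (v, i, j) @` cell a c = facet 3 a (third i j) (bit v (third i j)).
Proof.
move=> ij; have ? := a0; apply/seteqP; split.
  move=> _ [x [/andP[x1 x2] /andP[y1 y2]] <-].
  rewrite !intrD !mulrDr mulr1 in x2 y2; split.
    move=> k; rewrite mxE /mirror; apply/andP.
    by case: eqP => _; [|case: eqP => _]; case: (bit _ _); split; lra.
  rewrite mxE; move: i j ij; do 2 (apply: forall_I3); by [].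
move=> z [zb zk]; exists (pt (a * c.1%:~R + mirror a (bit v i) (z ord0 i))
                           (a * c.2%:~R + mirror a (bit v j) (z ord0 j))).
  have /andP[? ?] := zb i; have /andP[? ?] := zb j.
  rewrite /cell /= !ptE !intrD !mulrDr mulr1 /mirror.
  by split; apply/andP; case: (bit _ _); split; lra.
apply/rowP => k; rewrite mxE !ptE.
case: eqP => [->|ki]; first by rewrite /mirror; case: (bit _ _); ring.
case: eqP => [->|kj]; first by rewrite /mirror; case: (bit _ _); ring.
have -> : k = third i j by move: i j k ij ki kj {zk}; do 3 (apply: forall_I3).
by rewrite zk.
Qed.

End FoldMaps.

Section Facets.
Variables (R : realType) (a : R).
Hypothesis a0 : 0 < a.
Local Notation plane := 'rV[R]_2.
Local Notation space := 'rV[R]_3.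
Local Notation px x := (x ord0 (ord0 : 'I_2)).
Local Notation py x := (x ord0 (ord_max : 'I_2)).

Lemma mem_all_frames v i j : i != j -> (v, i, j) \in all_frames.
Proof.
move: v => [[[] []] []]; move: i j; do 2 (apply: forall_I3); by [].
Qed.

Lemma frame_axes_neq f : f \in all_frames -> f.1.2 != f.2.
Proof. by move: f; apply/allP; vm_compute. Qed.

Lemma axes_around (k : 'I_3) : exists i j,
  [/\ i != j, third i j = k & third j i = k].
Proof.
move: k; apply: forall_I3; [exists ax1, ax2|exists ax0, ax2|exists ax0, ax1] => //.
Qed.

Lemma sum_axes (F : 'I_3 -> R) i j : i != j ->
  \sum_k F k = F i + F j + F (third i j).
Proof.
move=> ij; rewrite sum_I3; move: i j ij.
do 2 (apply: forall_I3); rewrite //= => _; ring.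
Qed.

Lemma bits_exist (i j : 'I_3) bi bj bk : i != j ->
  exists v, [/\ bit v i = bi, bit v j = bj & bit v (third i j) = bk].
Proof.
move: i j; do 2 (apply: forall_I3); rewrite //= => _;
[exists (bi,bj,bk)|exists (bi,bk,bj)|exists (bj,bi,bk)|exists (bk,bi,bj)
  |exists (bj,bk,bi)|exists (bk,bj,bi)]; by [].
Qed.

Lemma third_neq i j : i != j -> third i j != i /\ third i j != j.
Proof. by move: i j; do 2 (apply: forall_I3). Qed.

Lemma third_cases i j k : i != j -> [\/ k = i, k = j | k = third i j].
Proof.
move: i j k; do 3 (apply: forall_I3); rewrite //= => _;
  by [constructor 1|constructor 2|constructor 3].
Qed.

(** [F] is affine with orthonormal directions.  These directions have no
    component along the axis [k], as the image lies in a plane orthogonal to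
    it, and [signed_permutation] applies to the two remaining coordinates. *)
Lemma facet_frame (F : plane -> space) c k b : isometric_on (cell a c) F ->
  F @` cell a c `<=` facet 3 a k b ->
  exists2 f, f \in all_frames /\ frame_face f = (k, b) &
    forall x, cell a c x -> F x = fold_map a c f x.
Proof.
move=> Fi Ff; pose o := lattice_pt a c.
have shift_cell x : box 2 a x -> cell a c (x + o).
  move/forall_I2=> [/andP[? ?] /andP[? ?]]; rewrite /cell /= !mxE /= !intrD.
  by split; apply/andP; split; lra.
pose G x := F (x + o).
have Gi : isometric_on (box 2 a) G.
  move=> x y bx by_; rewrite /G Fi; try exact: shift_cell.
  by rewrite !eucl_distE opprD addrACA subrr addr0.
have [||B [M [MM GE]]] := isometric_affine a0 Gi.
- by move=> l; rewrite mxE lexx ltW.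
- by move=> m l; rewrite !mxE eqxx /=; case: (l == m);
    rewrite ?mulr1 ?mulr0 ?lexx ltW.
have Gbox x : box 2 a x -> facet 3 a k b (B + x *m M).
  by move=> bx; rewrite -GE //; apply: Ff; exists (x + o) => //; exact: shift_cell.
have cornerE (e d : bool) l : (B + pt (e%:R * a) (d%:R * a) *m M) ord0 l =
    B ord0 l + (e%:R * a * M ord0 l + d%:R * a * M ord_max l).
  by rewrite !mxE sum_I2 !ptE.
have corner_box (e d : bool) : box 2 a (pt (e%:R * a) (d%:R * a)).
  apply/forall_I2; rewrite !ptE.
  by case: e d => [] []; rewrite /= ?mul1r ?mul0r ?lexx ?(ltW a0).
have bounds l (e d : bool) :
    0 <= B ord0 l + (e%:R * a * M ord0 l + d%:R * a * M ord_max l) <= a.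
  by rewrite -cornerE; have [h _] := Gbox _ (corner_box e d); exact: h.
have planar (e d : bool) :
    B ord0 k + (e%:R * a * M ord0 k + d%:R * a * M ord_max k) = if b then a else 0.
  by rewrite -cornerE; have [_ ->] := Gbox _ (corner_box e d).
have Bk : B ord0 k = if b then a else 0.
  by rewrite -(planar false false) !mul0r !addr0.
have uk : M ord0 k = 0.
  have := planar true false; rewrite mul1r !mul0r addr0 -Bk => h.
  have /eqP : a * M ord0 k = 0 by lra.
  by rewrite mulf_eq0 gt_eqF //= => /eqP.
have vk : M ord_max k = 0.
  have := planar false true; rewrite mul1r !mul0r add0r -Bk => h.
  have /eqP : a * M ord_max k = 0 by lra.
  by rewrite mulf_eq0 gt_eqF //= => /eqP.
have [i [j [ij kE kE']]] := axes_around k.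
have unit_row l : M l i ^+ 2 + M l j ^+ 2 = 1.
  have := congr1 (fun A : 'M[R]_2 => A l l) MM.
  rewrite mxE (sum_axes _ ij) !mxE eqxx kE !expr2.
  suff -> : M l k = 0 by rewrite mul0r addr0.
  by move: l; apply/forall_I2.
have ji : j != i by rewrite eq_sym.
have [sw [bi [bj swE]]] := signed_permutation a0 (unit_row _) (unit_row _)
  (bounds i) (bounds j).
have [v [vi vj vk']] := bits_exist bi bj b ij.
exists (if sw then (v, j, i) else (v, i, j)).
  by case: (sw); split; rewrite ?mem_all_frames //= ?kE' ?kE -?[in bit _ k]kE vk'.
move=> x cx; have bx : box 2 a (x - o).
  move: cx; rewrite /cell /= !intrD => -[/andP[? ?] /andP[? ?]].
  by apply/forall_I2; rewrite !mxE /=; split; apply/andP; split; lra.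
have -> : F x = B + (x - o) *m M by rewrite -GE // /G subrK.
have [h1 h2] := swE (px x - a * c.1%:~R) (py x - a * c.2%:~R).
have [ki kj] := third_neq ij; rewrite kE in ki kj.
apply/rowP => l; rewrite [LHS]mxE [X in _ + X]mxE sum_I2 !mxE /=.
have [->|->|->] := third_cases l ij.
- by rewrite h1; case: (sw); rewrite mxE eqxx ?(negPf ij) vi.
- by rewrite h2; case: (sw); rewrite mxE eqxx ?(negPf ji) vj.
- rewrite kE uk vk !mulr0 !addr0 Bk.
  by case: (sw); rewrite mxE (negPf ki) (negPf kj) -kE vk'.
Qed.

Definition interp (s : R) (P : bool -> space) : space :=
  (1 - s) *: P false + s *: P true.

Lemma intrD1 (n : int) : (n + 1)%:~R = n%:~R + 1 :> R.
Proof. by rewrite intrD. Qed.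

(** The one-dimensional case of [fold_map_agree]: two unit intervals with integer
    ends that share a point coincide or have one end in common, and that end is
    the shared point. *)
Lemma interp_agree (m n : int) (y : R) (P Q : bool -> space) :
  m%:~R <= y <= (m + 1)%:~R -> n%:~R <= y <= (n + 1)%:~R ->
  (forall e e' : bool, m + e%:R = n + e'%:R -> P e = Q e') ->
  interp (y - m%:~R) P = interp (y - n%:~R) Q.
Proof.
move=> /andP[m1 m2] /andP[n1 n2] PQ.
have h1 : m <= n + 1 by rewrite -(ler_int R); exact: le_trans n2.
have h2 : n <= m + 1 by rewrite -(ler_int R); exact: le_trans m2.
have [mn|[mn|mn]] : m = n \/ m = n + 1 \/ n = m + 1 by lia.
- by subst m; rewrite /interp (PQ false false) // (PQ true true).
- have n1y : y - n%:~R = 1.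
    by apply/eqP; rewrite subr_eq addrC -intrD1 eq_le n2 -mn m1.
  have m0y : y - m%:~R = 0 by rewrite mn intrD1 opprD addrA n1y subrr.
  rewrite /interp n1y m0y subr0 subrr !scale1r !scale0r addr0 add0r.
  by apply: PQ; rewrite mn addr0.
- have m1y : y - m%:~R = 1.
    by apply/eqP; rewrite subr_eq addrC -intrD1 eq_le m2 -mn n1.
  have n0y : y - n%:~R = 0 by rewrite mn intrD1 opprD addrA m1y subrr.
  rewrite /interp m1y n0y subr0 subrr !scale1r !scale0r addr0 add0r.
  by apply: PQ; rewrite mn addr0.
Qed.

(** An affine map on a square is the bilinear interpolation of its values at the
    corners; in this form agreement reduces to the corners, one coordinate at a
    time. *)
Lemma fold_map_interp c v i j x : i != j ->
  fold_map a c (v, i, j) x =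
  interp (px x / a - c.1%:~R) (fun e => interp (py x / a - c.2%:~R)
    (fun e' => vertex_pt a (frame_corner (v, i, j) (e, e')))).
Proof.
move=> ij; have a0' := lt0r_neq0 a0; apply/rowP => k; rewrite !mxE /mirror.
case: v => [[[] []] []]; move: i j k ij;
do 3 (apply: forall_I3); rewrite // /bit /toggle /= => _; by field.
Qed.

Lemma fold_map_agree c f c' f' x : f \in all_frames -> f' \in all_frames ->
  agree (c, f) (c', f') -> cell a c x -> cell a c' x ->
  fold_map a c f x = fold_map a c' f' x.
Proof.
move: f f' => [[v i] j] [[v' i'] j'] /frame_axes_neq ij /frame_axes_neq ij' ag.
have cell_div d : cell a d x -> d.1%:~R <= px x / a <= (d.1 + 1)%:~R /\
    d.2%:~R <= py x / a <= (d.2 + 1)%:~R.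
  by rewrite /cell /= !ler_pdivlMr // !ler_pdivrMr // ![_ * a]mulrC.
move=> /cell_div[x1 y1] /cell_div[x2 y2]; rewrite !fold_map_interp //.
apply: interp_agree x1 x2 _ => e1 e1' h1.
apply: interp_agree y1 y2 _ => e2 e2' h2; congr vertex_pt.
have /allP/(_ (e1, e2) (mem_bools2 _))/allP/(_ (e1', e2') (mem_bools2 _)) := ag.
by rewrite /corner /= h1 h2 eqxx => /eqP.
Qed.

Lemma cell_inj : injective (cell a).
Proof.
move=> c c' cc; have ? := a0.
have half d d' : cell a d = cell a d' -> d'.1 <= d.1 /\ d'.2 <= d.2.
  move=> dd; have : cell a d (lattice_pt a d).
    by apply: lattice_pt_cell => //; rewrite /incident; lia.
  rewrite dd /cell /= !ptE !ler_pM2l // !ler_int.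
  by move=> [/andP[? ?] /andP[? ?]].
have [] := half _ _ cc; have [] := half _ _ (esym cc).
by case: c c' {cc} => x y [x' y'] /= *; congr pair; lia.
Qed.

End Facets.

(** * Every unfolding is congruent to a net *)

Lemma card_eq_seq (T : choiceType) (A : set T) n : (A #= `I_n)%card ->
  exists s : seq T, [/\ uniq s, size s = n & A = [set` s]].
Proof.
move=> An; have Af : finite_set A by exists n.
exists (enum_fset (fset_set A)); split; first exact: fset_uniq.
  by apply/card_eq_fsetP; rewrite fset_setK.
by rewrite -[LHS]fset_setK.
Qed.

Section Necessity.
Variables (R : realType) (a : R) (h : 'rV[R]_3 -> 'rV[R]_3).
Hypothesis a0 : 0 < a.
Hypothesis hh : euclidean_isometry h.
Local Notation plane := 'rV[R]_2.

Definition copies_in (U : set (set plane)) (g : plane -> plane)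
  (s : seq cell_index) := forall c, c \in s -> U (g @` cell a c).

(** The folding map, read through [g] and through the inverse of [h], maps each
    lattice square of [s] isometrically onto a facet of the box, hence through a
    frame.  These frames follow the rolling rule since adjacent squares take
    the same values at the ends of their common edge. *)
Lemma copy_foldable U f g s : folding a h U f -> euclidean_isometry g ->
  copies_in U g s -> uniq s -> grown s -> foldable s.
Proof.
move=> [_ _ fi [ffun finj _]] gi sU us gs.
have [k [ki hK kK]] := euclidean_isometry_inv hh.
have [g' [_ gK _]] := euclidean_isometry_inv gi.
pose F := k \o (f \o g).
have Fframe c : exists p, c \in s -> [/\ p \in all_frames,
    forall x, cell a c x -> F x = fold_map a c p x &
    f @` (g @` cell a c) = h @` facet 3 a (frame_face p).1 (frame_face p).2].
  case: (boolP (c \in s)) => [cs|_]; last first.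
    by exists (false, false, false, ax0, ax1).
  have [i [b fE]] := ffun _ (sU _ cs).
  have Fi : isometric_on (cell a c) F.
    move=> x y cx cy; rewrite -(gi x y I I) -[RHS](fi _ (sU _ cs)).
    - exact: ki.
    - by exists x.
    - by exists y.
  have Fc : F @` cell a c `<=` facet 3 a i b.
    move=> _ [x cx <-]; have : (f @` (g @` cell a c)) (f (g x)).
      by exists (g x) => //; exists x.
    by rewrite fE /F /= => -[z zb <-]; rewrite hK.
  have [p [pa pf] pE] := facet_frame a0 Fi Fc.
  by exists p => _; split=> //; rewrite pf.
have [phi phiP] := boolp.choice Fframe.
have face_inj : {in s &, injective (frame_face \o phi)}.
  move=> c c' cs cs' /= ff; have [_ _ E] := phiP _ cs; have [_ _ E'] := phiP _ cs'.
  have : g @` cell a c = g @` cell a c'.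
    by apply: finj; [exact/mem_set/sU|exact/mem_set/sU|rewrite E E' ff].
  by move/(can_image_inj gK); exact: cell_inj.
case: s us gs sU Fframe phiP face_inj => // c0 s us gs sU Fframe phiP face_inj.
apply: (foldable_intro (phi := phi)) => //.
  by have [] := phiP _ (mem_last c0 s).
move=> d c cs ds; have [fa cE _] := phiP _ cs; have [fa' cE' _] := phiP _ ds.
apply: roll_unique => //; last first.
  apply/eqP => ff; have := step_neq d c.
  by rewrite -(face_inj _ _ cs ds ff) eqxx.
move=> y; apply: (vertex_pt_inj a0).
have corner_val p c1 e : p \in all_frames ->
    fold_map a c1 p (lattice_pt a (corner c1 e)) = vertex_pt a (frame_corner p e).
  by case: p => [[v i] j] /frame_axes_neq; exact: fold_map_corner.
have corner_cell c1 e : cell a c1 (lattice_pt a (corner c1 e)).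
  exact: (lattice_pt_cell a0 (corner_incident _ _)).
rewrite -(corner_val _ c _ fa) -(corner_val _ (step d c) _ fa').
by rewrite -cE // -cE' // step_corner.
Qed.

Lemma chain_exit (U : set (set plane)) (l : seq (set plane)) S T :
  edge_chain a U S T -> S \in l -> T \notin l ->
  exists P Q, [/\ P \in l, U Q, Q \notin l & share_edge a P Q].
Proof.
move=> [s [sU sp <-]]; elim: s S sU sp => [|Q s IH] S sU /=; first by move=> _ ->.
move=> /andP[/asboolP SQ sp] Sl Tl.
have [Ql|Ql] := boolP (Q \in l); last first.
  by exists S, Q; split=> //; apply: sU; rewrite !inE eqxx orbT.
by apply: (IH Q) => // P Ps; apply: sU; rewrite inE Ps orbT.
Qed.

(** As long as fewer than six squares are used, a chain of squares leaving the
    current copy provides a neighbor outside it.  The enlarged copy is foldable,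
    so it occurs in the next level up to a symmetry, by which the isometry
    [g] is corrected. *)
Lemma level_copy U n : unfolding a h U -> (n < 6)%N ->
  exists g s, [/\ euclidean_isometry g, s \in level n & copies_in U g s].
Proof.
move=> [U6 Usq _ [Uc _] [f Uf]]; have [l [ul sl UE]] := card_eq_seq U6.
elim: n => [_|n IH n6].
  have : exists S, S \in l.
    by case: l sl {ul UE} => // S l; exists S; rewrite mem_head.
  move=> [S Sl]; have US : U S by rewrite UE.
  have [g gi SE] := Usq _ US; exists g, [:: (0, 0)]; split=> // c.
  by rewrite inE => /eqP ->; rewrite cell0 -SE.
have [g [s [gi sn sU]]] := IH (ltnW n6); have [ss us gs] := level_grown sn.
pose m := [seq g @` cell a c | c <- s].
have map_m c : c \in s -> g @` cell a c \in m.
  exact: (map_f (fun c => g @` cell a c)).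
have [T Tl Tm] : exists2 T, T \in l & T \notin m.
  apply/hasP; apply: contraTT n6 => /hasPn lm; rewrite -leqNgt -ltnS -sl -ss.
  rewrite -(size_map (fun c => g @` cell a c) s) ltnS.
  apply: uniq_leq_size => // T /lm.
  by rewrite negbK.
have [c0 c0s] : exists c, c \in s.
  by case: s ss {sn sU us gs m map_m Tm} => // c s; exists c; rewrite mem_head.
have [|P [Q [/mapP[c cs ->] UQ Qm PQ]]] :=
  @chain_exit _ m _ _ (Uc _ _ (sU _ c0s) (_ : U T)) (map_m _ c0s) Tm.
  by rewrite UE.
have [|c' cc' QE] := share_edge_neighbor a0 gi PQ.
  by move=> QE; case/negP: Qm; rewrite QE; exact: map_m.
have c's : c' \notin s by apply: contra Qm => c's; rewrite QE; exact: map_m.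
have sU' : copies_in U g (c' :: s).
  by move=> x; rewrite inE => /orP[/eqP->|/sU//]; rewrite -QE.
have gs' : grown (c' :: s).
  by rewrite /= gs andbT; apply/orP; right; apply/hasP; exists c.
have us' : uniq (c' :: s) by rewrite /= c's.
have fs' := copy_foldable Uf gi sU' us' gs'.
have [t tn /embedsP[z zP]] := next_level_complete sn cs cc' c's fs'.
exists (g \o sym_pt a z), t; split=> //.
  exact: euclidean_isometry_comp (sym_pt_isometry _ _).
by move=> x /zP/sU'; rewrite -image_comp sym_pt_image.
Qed.

Definition squares (s : seq cell_index) : set (set plane) :=
  [set cell a c | c in [set` s]].

Lemma unfolding_congruent_net U : unfolding a h U ->
  exists2 t, t \in nets & congruent (squares t) U.
Proof.
move=> Uu; have [g [s [gi sl sU]]] := level_copy Uu (isT : (5 < 6)%N).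
have [t tn /embedsP[z zP]] := nets_complete sl.
(* A closing tactic would evaluate the enumeration in this hypothesis. *)
clear sl; exists t => //.
pose k := g \o sym_pt a z.
have ki : euclidean_isometry k by exact: euclidean_isometry_comp (sym_pt_isometry _ _).
have [k' [_ kK _]] := euclidean_isometry_inv ki.
exists k => //.
have tU c : c \in t -> U (k @` cell a c).
  by move=> /zP/sU; rewrite /k -image_comp sym_pt_image.
have [U6 _ _ _ _] := Uu; have [l [ul l6 UE]] := card_eq_seq U6.
have [t6 ut _ _ _] := nets_realizable tn.
pose m := [seq k @` cell a c | c <- t].
have um : uniq m.
  rewrite map_inj_uniq // => c c' /(can_image_inj kK); exact: cell_inj.
have ml : {subset m <= l}.
  by move=> S /mapP[c /tU US ->]; move: US; rewrite UE.
have [|_ lm] := uniq_min_size um ml; first by rewrite size_map t6 l6.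
rewrite UE; apply/seteqP; split=> S /=; last first.
  by move=> [_ [c ct <-] <-]; apply: ml; exact: (map_f (fun c => k @` cell a c)).
rewrite -lm => /mapP[c ct ->].
by exists (cell a c) => //; exists c.
Qed.

End Necessity.

(** * Arrangements of lattice squares *)

Section CellAdjacency.
Variables (R : realType) (a : R).
Hypothesis a0 : 0 < a.
Local Notation plane := 'rV[R]_2.

Definition translation (c : cell_index) := sym_pt a (LatticeSym false false false c).

Lemma translation_isometry c : euclidean_isometry (translation c).
Proof. exact: sym_pt_isometry. Qed.

Lemma translation_cell c d x :
  cell a (c.1 + d.1, c.2 + d.2) (translation c x) <-> cell a d x.
Proof. exact: sym_pt_cell. Qed.

Lemma translation_box c x : cell a c (translation c x) <-> box 2 a x.
Proof.
by have := translation_cell c (0, 0) x; rewrite cell0 /= !addr0; case: c.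
Qed.

Lemma translation_boxE c : cell a c = translation c @` box 2 a.
Proof.
exact/esym/(isometry_image (translation_isometry c) (translation_box c)).
Qed.

Lemma cell_square c : is_square a (cell a c).
Proof.
by exists (translation c); [exact: translation_isometry|exact: translation_boxE].
Qed.

Lemma step_edge c d : edge_of a (cell a c) (cell a c `&` cell a (step d c)).
Proof.
exists (translation c); split; [exact: translation_isometry|exact: translation_boxE|].
exists (if d.1 then ord_max else ord0), d.2.
apply/esym/(isometry_image (translation_isometry c)) => x.
have -> : step d c = (c.1 + (step d (0, 0)).1, c.2 + (step d (0, 0)).2).
  by case: d => [] [] []; rewrite /step /= ?addr0 ?add0r.
have ? := a0.
suff local : box 2 a x -> cell a (step d (0, 0)) x <->
    x ord0 (if d.1 then ord_max else ord0) = if d.2 then a else 0.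
  split=> [[/translation_box bx /translation_cell /(local bx) h]|[bx h]].
    by split.
  by split; [exact/translation_box|exact/translation_cell/(local bx)].
move=> /forall_I2[/andP[? ?] /andP[? ?]]; rewrite /cell /=.
case: d => -[] [] /=; split=> [[/andP[? ?] /andP[? ?]]|?];
  by [lra|split; apply/andP; split; lra].
Qed.

Lemma step_share_edge c d : share_edge a (cell a c) (cell a (step d c)).
Proof.
split; first exact: step_edge.
have := step_edge (step d c) (d.1, ~~ d.2).
suff -> : step (d.1, ~~ d.2) (step d c) = c by rewrite setIC.
by case: d c => [] [] [] [x y]; rewrite /step /=; congr pair; lia.
Qed.

Definition diagonal (e : bool * bool) (c : cell_index) : cell_index :=
  (c.1 + (-1) ^+ (~~ e.1), c.2 + (-1) ^+ (~~ e.2)).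

Lemma diagonal_share_corner c e : share_corner a (cell a c) (cell a (diagonal e c)).
Proof.
have corner_ofP d f : corner_of a (cell a d) (lattice_pt a (corner d f)).
  exists (translation d); split; first exact: translation_isometry.
    exact: translation_boxE.
  exists (lattice_pt a (corner (0, 0) f)).
    by apply/forall_I2; rewrite !ptE; case: f => [] [] [];
      rewrite /= !(addr0, add0r, mulr0, mulr1); split; auto.
  by apply: plane_eq; rewrite /translation /sym_pt /lattice_pt !ptE /= add0r
    intrD mulrDr.
exists (lattice_pt a (corner c e)); split; last 2 first.
- exact: corner_ofP.
- suff -> : corner c e = corner (diagonal e c) (~~ e.1, ~~ e.2) by exact: corner_ofP.
  by case: e => [] [] []; rewrite /corner /diagonal /=; congr pair; lia.
have ? := a0; apply/seteqP; split=> x.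
  case=> -[/andP[? ?] /andP[? ?]] []; rewrite /diagonal.
  case: e => -[] [] /= /andP[? ?] /andP[? ?];
    apply: plane_eq; rewrite !ptE /corner /= ?addr0; lra.
move=> ->; split; apply: lattice_pt_cell => //.
  exact: corner_incident.
by case: e => [] [] []; rewrite /incident /corner /diagonal /=; lia.
Qed.

End CellAdjacency.

Lemma int_squeeze (m n : int) : m < n + 1 -> n < m + 1 -> m = n.
Proof. by lia. Qed.

Section Regions.
Variables (R : realType) (a : R).
Hypothesis a0 : 0 < a.
Local Notation plane := 'rV[R]_2.
Local Notation px x := (x ord0 (ord0 : 'I_2)).
Local Notation py x := (x ord0 (ord_max : 'I_2)).

Lemma cells_touch c d x : cell a c x -> cell a d x -> d \in block c.
Proof.
have le (m n : int) (y : R) : a * m%:~R <= y -> y <= a * (n + 1)%:~R -> m <= n + 1.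
  by move=> h1 h2; rewrite -(ler_int R) -(ler_pM2l a0); exact: le_trans h2.
move=> [/andP[h1 h2] /andP[h3 h4]] [/andP[h5 h6] /andP[h7 h8]].
have := le _ _ _ h1 h6; have := le _ _ _ h5 h2.
have := le _ _ _ h3 h8; have := le _ _ _ h7 h4.
case: c d {h1 h2 h3 h4 h5 h6 h7 h8} => [c1 c2] [d1 d2] /= *.
apply/allpairsP; exists (d1 - c1, d2 - c2); split=> /=.
- by rewrite !inE; lia.
- by rewrite !inE; lia.
- by congr pair; lia.
Qed.

Lemma block_cases c d : d \in block c ->
  [\/ d = c, exists e, d = step e c | exists e, d = diagonal e c].
Proof.
case/allpairsP=> -[x y] /= [xb yb ->]; move: xb yb; rewrite !inE.
case/or3P=> /eqP-> /or3P[] /eqP->; rewrite /step /diagonal /=.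
- by constructor 3; exists (false, false).
- by constructor 2; exists (false, false); rewrite addr0.
- by constructor 3; exists (false, true).
- by constructor 2; exists (true, false); rewrite addr0.
- by constructor 1; case: c => u v; rewrite !addr0.
- by constructor 2; exists (true, true); rewrite addr0.
- by constructor 3; exists (true, false).
- by constructor 2; exists (false, true); rewrite addr0.
- by constructor 3; exists (true, true).
Qed.

Lemma squares_joined s : joined_along_edges a (squares a s).
Proof.
move=> _ _ [c cs <-] [d ds <-] cd.
have [->|/set0P[x [cx dx]]] := eqVneq (cell a c `&` cell a d) set0.
  by constructor 1.
have [dc|[e ->]|[e ->]] := block_cases (cells_touch cx dx).
- by case: cd; rewrite dc.
- by constructor 3; exact: step_share_edge.
- by constructor 2; exact: diagonal_share_corner.
Qed.

Lemma edge_chain_sub (U V : set (set plane)) S T :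
  U `<=` V -> edge_chain a U S T -> edge_chain a V S T.
Proof. by move=> UV [l [lU lp lT]]; exists l; split=> // Q /lU/UV. Qed.

Lemma edge_chain_refl (U : set (set plane)) S : U S -> edge_chain a U S S.
Proof. by move=> US; exists [::]; split=> // Q; rewrite inE => /eqP->. Qed.

Lemma edge_chain_trans (U : set (set plane)) S T Q :
  edge_chain a U S T -> edge_chain a U T Q -> edge_chain a U S Q.
Proof.
move=> [l [lU lp lT]] [m [mU mp mT]]; exists (l ++ m); split.
- move=> P; rewrite -cat_cons mem_cat => /orP[/lU//|Pm].
  by apply: mU; rewrite inE Pm orbT.
- by rewrite cat_path lp lT.
- by rewrite last_cat lT.
Qed.

Lemma edge_chain_step (U : set (set plane)) S T :
  U S -> U T -> share_edge a S T -> edge_chain a U S T.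
Proof.
move=> US UT ST; exists [:: T]; split=> //=; last by rewrite andbT; apply/asboolP.
by move=> Q; rewrite !inE => /orP[] /eqP->.
Qed.

Lemma share_edge_sym (S T : set plane) : share_edge a S T -> share_edge a T S.
Proof. by rewrite /share_edge setIC => -[]. Qed.

(** The newest square is linked in both directions to an older neighbor [x], and
    all the older squares are linked to [x] by induction. *)
Lemma grown_chain s : grown s -> forall c d, c \in s -> d \in s ->
  edge_chain a (squares a s) (cell a c) (cell a d).
Proof.
elim: s => // c s IH gs.
have sub : squares a s `<=` squares a (c :: s).
  by move=> _ [d ds <-]; exists d => //=; rewrite inE ds orbT.
have inU d : d \in c :: s -> squares a (c :: s) (cell a d) by exists d.
have [s0|[x xs cx]] : s = [::] \/ exists2 x, x \in s & c \in neighbors x.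
  move: gs => /= /orP[/nilP->|/andP[/hasP h _]]; first by left.
  by right; case: h => x; exists x.
  rewrite s0 => d e; rewrite !inE => /eqP-> /eqP->.
  by apply: edge_chain_refl; exists c => //=; rewrite mem_head.
have gs' : grown s by move: gs => /= /orP[/nilP->|/andP[]].
have sh : share_edge a (cell a x) (cell a c).
  by have [d _ ->] := neighbors_step cx; exact: step_share_edge.
have to_x d : d \in c :: s ->
    edge_chain a (squares a (c :: s)) (cell a d) (cell a x) /\
    edge_chain a (squares a (c :: s)) (cell a x) (cell a d).
  have xU : squares a (c :: s) (cell a x) by apply: inU; rewrite inE xs orbT.
  have cU := inU c (mem_head _ _).
  rewrite inE => /orP[/eqP->|ds].
    split; last exact: edge_chain_step.
    by apply: edge_chain_step => //; exact: share_edge_sym.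
  by split; apply: (edge_chain_sub sub); exact: IH.
by move=> d e /to_x[h _] /to_x[_ h']; exact: edge_chain_trans h'.
Qed.

(** * The boundary of an arrangement *)

Definition region (s : seq cell_index) : set plane :=
  [set x | exists2 c, c \in s & cell a c x].

Lemma region_squares s : squares_union (squares a s) = region s.
Proof.
apply/seteqP; split=> x; first by move=> [_ [c cs <-] cx]; exists c.
by move=> [c cs cx]; exists (cell a c) => //; exists c.
Qed.

Lemma region_cons c s : region (c :: s) = cell a c `|` region s.
Proof.
apply/seteqP; split=> x.
  by move=> [d]; rewrite inE => /orP[/eqP-> dx|ds dx]; [left|right; exists d].
case=> [cx|[d ds dx]]; first by exists c => //; rewrite mem_head.
by exists d => //; rewrite inE ds orbT.
Qed.

Lemma cell_closed c : closed (cell a c).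
Proof.
have itv (i : 'I_2) (u v : R) : closed [set x : plane | u <= x ord0 i <= v].
  rewrite (_ : mkset _ = (fun x : plane => x ord0 i) @^-1` `[u, v]%classic).
    apply: closed_comp; last exact: itv_closed.
    by move=> x _; exact: coord_continuous.
  by apply/seteqP; split=> x /=; rewrite in_itv.
exact: (closedI (itv _ _ _) (itv _ _ _)).
Qed.

Lemma region_closed s : closed (region s).
Proof.
elim: s => [|c s IH]; last first.
  by rewrite region_cons; apply: closedU; [exact: cell_closed|exact: IH].
rewrite (_ : region [::] = set0); first exact: closed0.
by apply/seteqP; split=> // x [].
Qed.

(** Finitely many closed cells that miss [x] miss a neighborhood of [x]. *)
Lemma near_avoid (l : seq cell_index) (P : pred cell_index) x :
  (forall c, c \in l -> P c -> ~ cell a c x) ->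
  nbhs x [set y | forall c, c \in l -> P c -> ~ cell a c y].
Proof.
elim: l => [|c l IH] h; first exact: filterE.
have hl : nbhs x [set y | forall d, d \in l -> P d -> ~ cell a d y].
  by apply: IH => d dl; apply: h; rewrite inE dl orbT.
have hc : nbhs x [set y | P c -> ~ cell a c y].
  have [Pc|nPc] := boolP (P c); last exact: filterE.
  have : nbhs x (~` cell a c).
    apply: open_nbhs_nbhs; split; first exact/closed_openC/cell_closed.
    by apply: h => //; rewrite mem_head.
  by apply: filterS => y ny _; exact: ny.
near=> y => d; rewrite inE => /orP[/eqP->|].
  by near: y.
by move: d; near: y.
Unshelve. all: by end_near.
Qed.

Lemma ball_rowE n (x y : 'rV[R]_n) e : 0 < e ->
  ball x e y <-> forall i, `|x ord0 i - y ord0 i| < e.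
Proof.
move=> e0; split=> [[_ h] i|h]; first exact: h.
by split=> // i j; rewrite ord1; exact: h.
Qed.

Lemma near_block c x : cell a c x ->
  nbhs x [set y | exists2 d, d \in block c & cell a d y].
Proof.
move=> [/andP[x1 x2] /andP[x3 x4]]; apply/nbhs_ballP.
exists a => //= y /(ball_rowE _ _ a0)/forall_I2[].
have near1 (m : int) (u v : R) : a * m%:~R <= u -> u <= a * (m + 1)%:~R ->
    `|u - v| < a -> exists2 k : int, k \in [:: -1; 0; 1] &
      a * (m + k)%:~R <= v <= a * (m + k + 1)%:~R.
  rewrite ltr_norml intrD => h1 h2 /andP[h3 h4].
  have [vm|mv] := ltP v (a * m%:~R).
    by exists (-1) => //; rewrite !intrD; apply/andP; split; lra.
  have [vm|mv'] := ltP v (a * m%:~R + a).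
    by exists 0 => //; rewrite !intrD; apply/andP; split; lra.
  by exists 1 => //; rewrite !intrD; apply/andP; split; lra.
move=> /(near1 _ _ _ x1 x2)[k kb h] /(near1 _ _ _ x3 x4)[l lb h'].
exists (c.1 + k, c.2 + l) => //.
by apply/allpairsP; exists (k, l).
Qed.

(** Moving [x] slightly towards the center of the outer cell [c] gives points of
    the interior of [c], which lie in no other lattice cell. *)
Lemma not_interior s c x : c \notin s -> cell a c x -> ~ interior (region s) x.
Proof.
move=> cs [/andP[x1 x2] /andP[x3 x4]] /nbhs_ballP[e /= e0 es]; have ? := a0.
(* This ratio is less than 1, and a displacement of at most [t * a] is less
   than [e]. *)
pose t := e / (a + e).
have t0 : 0 < t by rewrite divr_gt0 // addr_gt0.
have t1 : t < 1 by rewrite ltr_pdivrMr ?addr_gt0 // mul1r ltrDr.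
have ta : t * a < e.
  by rewrite /t mulrAC ltr_pdivrMr ?addr_gt0 // ltr_pM2l // ltrDl.
rewrite !intrD in x2 x4.
have push (n : int) (u : R) : a * n%:~R <= u -> u <= a * (n%:~R + 1) ->
   let v := u + t * (a * n%:~R + a / 2 - u) in
   [/\ `|u - v| < e, a * n%:~R < v & v < a * (n + 1)%:~R].
  move=> h1 h2 v.
  have tu : 0 <= t * (u - a * n%:~R) by rewrite mulr_ge0 ?subr_ge0 // ltW.
  have tv : 0 <= t * (a * (n%:~R + 1) - u) by rewrite mulr_ge0 ?subr_ge0 // ltW.
  have tt : 0 < t * a by rewrite mulr_gt0.
  have tu' : 0 <= (1 - t) * (u - a * n%:~R) by rewrite mulr_ge0 ?subr_ge0 // ltW.
  have tv' : 0 <= (1 - t) * (a * (n%:~R + 1) - u).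
    by rewrite mulr_ge0 ?subr_ge0 // ltW.
  rewrite /v intrD; split; [|nra|nra].
  by rewrite ltr_norml; apply/andP; split; nra.
have [b1 l1 r1] := push _ _ x1 x2; have [b2 l2 r2] := push _ _ x3 x4.
have [|d ds [/andP[d1 d2] /andP[d3 d4]]] := es (pt
    (px x + t * (a * c.1%:~R + a / 2 - px x))
    (py x + t * (a * c.2%:~R + a / 2 - py x))).
  by apply/ball_rowE => //; apply/forall_I2; rewrite !ptE.
rewrite !ptE in d1 d2 d3 d4.
have lt (m n : int) (y : R) : a * m%:~R < y -> y <= a * (n + 1)%:~R -> m < n + 1.
  by move=> h1 h2; rewrite -(ltr_int R) -(ltr_pM2l a0); exact: lt_le_trans h2.
have lt' (m n : int) (y : R) : a * m%:~R <= y -> y < a * (n + 1)%:~R -> m < n + 1.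
  by move=> h1 h2; rewrite -(ltr_int R) -(ltr_pM2l a0); exact: le_lt_trans h2.
have e1 : d.1 = c.1 := int_squeeze (lt' _ _ _ d1 r1) (lt _ _ _ l1 d2).
have e2 : d.2 = c.2 := int_squeeze (lt' _ _ _ d3 r2) (lt _ _ _ l2 d4).
by case/negP: cs; rewrite [c]surjective_pairing -e1 -e2 -surjective_pairing.
Qed.

(** A point of the region is interior exactly when all the lattice cells that
    contain it belong to the region. *)
Lemma boundary_region s : boundary (region s) =
  [set x | exists2 p, p \in boundary_pieces s & cell a p.1 x /\ cell a p.2 x].
Proof.
rewrite /boundary -(closure_id _).1; last exact: region_closed.
apply/seteqP; split=> x.
  move=> [[c cs cx] nint]; apply: contrapT => nb; apply: nint.
  have av : nbhs x [set y | forall d, d \in block c -> d \notin s -> ~ cell a d y].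
    apply: near_avoid => d dc ds dx; apply: nb; exists (c, d) => //.
    rewrite mem_filter ds; apply/allpairsPdep; exists c, d; split=> //.
  rewrite /interior; have := near_block cx; move: av.
  apply: filterS2 => y h [d db dy].
  exists d => //; apply: contrapT => /negP ds; exact: h dy.
move=> [[c d]]; rewrite mem_filter => /andP[ds /allpairsPdep[c' [d' [cs _]]]].
case=> cE dE [cx dx]; subst c d; split; first by exists c'.
exact: (not_interior ds dx).
Qed.

Lemma star_connected (A : set plane) x0 : A x0 ->
  (forall y t, A y -> 0 <= t <= 1 -> A (x0 + t *: (y - x0))) -> connected A.
Proof.
move=> Ax0 star; pose seg y := (fun t : R => x0 + t *: (y - x0)) @` `[0, 1]%classic.
rewrite (_ : A = \bigcup_(y in A) seg y); last first.
  apply/seteqP; split=> [y Ay|x [y Ay [t]]].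
    exists y => //; exists 1; rewrite /= ?in_itv /= ?ler01 ?lexx //.
    by rewrite scale1r addrC subrK.
  by rewrite /= in_itv /= => t01 <-; exact: star.
apply: bigcup_connected => [|y _].
  exists x0 => y _; exists 0; rewrite /= ?in_itv /= ?ler01 ?lexx //.
  by rewrite scale0r addr0.
apply: connected_continuous_connected; first exact: segment_connected.
apply: continuous_subspaceT => t.
by apply: cvgD; [exact: cvg_cst|apply: cvgZl; exact: cvg_id].
Qed.

Definition piece (p : cell_index * cell_index) : set plane := cell a p.1 `&` cell a p.2.

Lemma itv_convex (u v x y t : R) : u <= x <= v -> u <= y <= v -> 0 <= t <= 1 ->
  u <= x + t * (y - x) <= v.
Proof.
move=> /andP[? ?] /andP[? ?] /andP[? ?].
have le (r s : R) : 0 <= r -> 0 <= s -> 0 <= (1 - t) * r + t * s.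
  by move=> ? ?; rewrite addr_ge0 // mulr_ge0 // subr_ge0.
have hu : 0 <= (1 - t) * (x - u) + t * (y - u) by apply: le; rewrite subr_ge0.
have hv : 0 <= (1 - t) * (v - x) + t * (v - y) by apply: le; rewrite subr_ge0.
by apply/andP; split; lra.
Qed.

Lemma piece_connected p : connected (piece p).
Proof.
have [->|/set0P[x px]] := eqVneq (piece p) set0; first exact: connected0.
apply: (star_connected px) => y t py t01.
have cell_star c : cell a c x -> cell a c y -> cell a c (x + t *: (y - x)).
  by move=> [x1 x2] [y1 y2]; rewrite /cell /= !mxE; split; apply: itv_convex.
by case: px py => [x1 x2] [y1 y2]; split; exact: cell_star.
Qed.

Definition pieces_union (l : seq (cell_index * cell_index)) : set plane :=
  [set x | exists2 p, p \in l & piece p x].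

Lemma pieces_union_cons p l : pieces_union (p :: l) = piece p `|` pieces_union l.
Proof.
apply/seteqP; split=> x.
  by move=> [q]; rewrite inE => /orP[/eqP->|ql] qx; [left|right; exists q].
case=> [px|[q ql qx]]; first by exists p => //; rewrite mem_head.
by exists q => //; rewrite inE ql orbT.
Qed.

Lemma meets_piece p q : meets p q -> piece p `&` piece q !=set0.
Proof.
by case/hasP=> e _ /and4P[h1 h2 h3 h4]; exists (lattice_pt a (corner p.1 e));
  split; split; exact: (lattice_pt_cell a0).
Qed.

Lemma near_connected near acc : all (fun p => has (meets p) acc) near ->
  connected (pieces_union acc) -> connected (pieces_union (near ++ acc)).
Proof.
move=> + accC; elim: near => //= p near IH /andP[/hasP[q qa pq] /IH C].
rewrite pieces_union_cons; apply: connectedU => //; last exact: piece_connected.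
have [x [px qx]] := meets_piece pq; exists x; split=> //.
by exists q => //; rewrite mem_cat qa orbT.
Qed.

Lemma linked_connected n acc todo : linked n acc todo ->
  connected (pieces_union acc) -> connected (pieces_union (acc ++ todo)).
Proof.
elim: n acc todo => [|n IH] acc todo /=; first by move/nilP->; rewrite cats0.
set near := [seq p <- todo | _]; set far := [seq p <- todo | _] => /IH h accC.
have := h (near_connected _ accC).
rewrite (_ : pieces_union _ = pieces_union (acc ++ todo)).
  by apply; apply: filter_all.
apply/seteqP; split=> x [p pl px]; exists p => //; move: pl; rewrite !mem_cat !mem_filter.
  by move=> /orP[/orP[/andP[_ ->]|->]|/andP[_ ->]]; rewrite ?orbT.
by case: (has _ _) => /orP[] ->; rewrite ?orbT.
Qed.

(** The boundary is the union of the pieces, which is connected by the search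
    and is therefore its only component. *)
Lemma boundary_connected s : boundary_linked s ->
  (components (boundary (squares_union (squares a s))) #= `I_1)%card.
Proof.
rewrite /boundary_linked region_squares boundary_region.
case sE: (boundary_pieces s) => [//|p l] /andP[pp lk].
rewrite -/(pieces_union (p :: l)).
have C : connected (pieces_union (p :: l)).
  apply: (linked_connected lk); rewrite pieces_union_cons.
  rewrite (_ : pieces_union [::] = set0) ?setU0; first exact: piece_connected.
  by apply/seteqP; split=> // x [].
have [x0 [x0p _]] := meets_piece pp.
set B := pieces_union _ in C *.
have Bx0 : B x0 by exists p => //; rewrite mem_head.
rewrite (_ : components B = [set B]); first exact: card_set1.
apply/seteqP; split=> [_ [x Bx <-]|_ ->].
  by rewrite /= connected_component_id.
by exists x0 => //; rewrite connected_component_id.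
Qed.

End Regions.

(** * Folding a net *)

Lemma uniq_map_inj (T U : eqType) (f : T -> U) (s : seq T) :
  uniq [seq f x | x <- s] -> {in s &, injective f}.
Proof.
elim: s => //= x s IH /andP[xs us] y z; rewrite !inE.
move=> /orP[/eqP->|ys] /orP[/eqP->|zs] // E; last exact: IH.
- by case/negP: xs; rewrite E map_f.
- by case/negP: xs; rewrite -E map_f.
Qed.

Section Folding.
Variables (R : realType) (a : R) (h : 'rV[R]_3 -> 'rV[R]_3).
Hypothesis a0 : 0 < a.
Hypothesis hh : euclidean_isometry h.
Local Notation plane := 'rV[R]_2.
Local Notation space := 'rV[R]_3.

(** The topology comes from the sup norm; in dimension [n] a sup distance below
    [e / (n + 1)] gives a Euclidean distance below [e], which bounds each
    coordinate. *)
Lemma isometric_continuous n m (f : 'rV[R]_n -> 'rV[R]_m) :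
  isometric_on setT f -> continuous f.
Proof.
move=> fi x A /nbhs_ballP[e /= e0 eA].
have d0 : 0 < e / n.+1%:R by rewrite divr_gt0.
rewrite nbhs_filterE; apply/nbhs_ballP.
exists (e / n.+1%:R) => //= y /(ball_rowE _ _ d0) xy.
apply: eA; apply/ball_rowE => // i.
have /eucl_dist_eq := fi x y I I; rewrite !dotE => E.
rewrite -(@ltr_pXn2r _ 2) ?nnegrE // ?ltW // real_normK ?num_real //.
have le1 : (f x ord0 i - f y ord0 i) ^+ 2 <=
    \sum_j (f x - f y) 0 j * (f x - f y) 0 j.
  rewrite (bigD1 i) //= !mxE -expr2 lerDl sumr_ge0 // => j _.
  by rewrite -expr2 sqr_ge0.
apply: le_lt_trans le1 _; rewrite E.
apply: (@le_lt_trans _ _ (\sum_(j < n) (e / n.+1%:R) ^+ 2)).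
  apply: ler_sum => j _; rewrite -expr2 -[leLHS]real_normK ?num_real //.
  by rewrite ler_pXn2r ?nnegrE // ?ltW // !mxE.
rewrite sumr_const card_ord -[ltLHS]mulr_natl expr_div_n mulrCA -[ltRHS]mulr1.
rewrite ltr_pM2l ?exprn_gt0 // ltr_pdivrMr ?exprn_gt0 // mul1r -natrX ltr_nat.
by rewrite expnS expn1 mulSn ltn_addr // ltnS.
Qed.

(** On a common edge the first square of the list prevails; [glueE] shows that
    the choice is immaterial when the frames agree. *)
Fixpoint glue (l : seq (cell_index * frame)) (x : plane) : space :=
  if l is (c, p) :: l' then
    if `[< cell a c x >] then fold_map a c p x else glue l' x
  else 0.

Definition nondegenerate (p : cell_index * frame) := p.2.1.2 != p.2.2.

Lemma glueE l c p x : all nondegenerate l -> allrel agree l l ->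
  (c, p) \in l -> cell a c x -> glue l x = fold_map a c p x.
Proof.
move=> /allP lp /allrelP lag; have : {subset l <= l} by [].
elim: {1 3 4}l => //= -[d q] l' IH sub cl cx.
have frameP y : y \in l -> y.2 \in all_frames.
  by move=> /lp; case: y => ? [[v i] j] /= ?; exact: mem_all_frames.
have dl : (d, q) \in l by apply: sub; rewrite mem_head.
have cl' := sub _ cl.
case: asboolP => [dx|ndx].
  apply: (fold_map_agree a0) => //; [exact: (frameP _ dl)|exact: (frameP _ cl')|].
  exact: lag.
move: cl; rewrite inE => /orP[/eqP[cd _]|cl]; first by case: ndx; rewrite -cd.
by apply: IH => // y yl; apply: sub; rewrite inE yl orbT.
Qed.

Lemma glue_continuous L l : all nondegenerate L -> allrel agree L L -> {subset l <= L} ->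
  {within region a [seq p.1 | p <- l], continuous (h \o glue L)}.
Proof.
move=> Lp La; elim: l => [|[c [[v i] j]] l IH] sub.
  rewrite (_ : region a _ = set0); first exact: continuous_subspace0.
  by apply/seteqP; split=> // x [].
have cL : (c, (v, i, j)) \in L by apply: sub; rewrite mem_head.
have ij : i != j by exact: (allP Lp _ cL).
rewrite /= region_cons; apply: withinU_continuous.
- exact: cell_closed.
- exact: region_closed.
- apply: (@subspace_eq_continuous _ _ _ (h \o fold_map a c (v, i, j))).
    move=> x /set_mem cx.
    change (h (fold_map a c (v, i, j) x) = h (glue L x)).
    by rewrite (glueE Lp La cL).
  apply: continuous_subspaceT; apply: isometric_continuous => x y _ _.
  by rewrite hh //; exact: fold_map_isometric.
- by apply: IH => y yl; apply: sub; rewrite inE yl orbT.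
Qed.

(** The center of a facet lies in no other facet. *)
Lemma facet_inj (k k' : 'I_3) (b b' : bool) :
  facet 3 a k b = facet 3 a k' b' -> (k, b) = (k', b').
Proof.
have ? := a0.
move=> E; pose z : space := \row_i (if i == k then if b then a else 0 else a / 2).
have : facet 3 a k b z.
  split=> [i|]; rewrite mxE ?eqxx //.
  by case: eqP => _; [case: (b)|]; apply/andP; split; lra.
rewrite E => -[_]; rewrite mxE; have [<-|_] := eqVneq k' k.
  by case: (b); case: (b') => //= ?; exfalso; lra.
by case: (b') => /= ?; exfalso; lra.
Qed.

Lemma fold_frames_cells f0 s : [seq p.1 | p <- fold_frames f0 s] = s.
Proof. by elim: s => //= c s ->. Qed.

(** Each square goes onto the facet named by its frame; these facets are
    distinct and exhaust the six facets. *)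
Lemma squares_folding s : folds_up s ->
  folding a h (squares a s) (h \o glue (net_frames s)).
Proof.
set L := net_frames s => /and4P[Lp La Lu Lf].
have [k [ki hK kK]] := euclidean_isometry_inv hh.
have cellsL : [seq p.1 | p <- L] = s by exact: fold_frames_cells.
have frame_of c : c \in s -> exists p, (c, p) \in L.
  by rewrite -cellsL => /mapP[[d p] dL /= ->]; exists p.
have cell_image c p : (c, p) \in L -> (h \o glue L) @` cell a c =
    h @` facet 3 a (frame_face p).1 (frame_face p).2.
  move=> cL; rewrite -image_comp; congr (h @` _).
  case: p cL => [[v i] j] cL; rewrite /= -(fold_map_image a0 c v (allP Lp _ cL)).
  by apply/eq_imagel => x; exact: glueE cL.
have bij : set_bij (squares a s) (cube_faces a h) (fun S => (h \o glue L) @` S).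
  split.
  - move=> _ [c /frame_of[p cL] <-]; rewrite (cell_image _ _ cL).
    by exists (frame_face p).1, (frame_face p).2.
  - move=> S T /set_mem[c /frame_of[p cL] <-] /set_mem[d /frame_of[q dL] <-].
    rewrite (cell_image _ _ cL) (cell_image _ _ dL) => /(can_image_inj hK)/facet_inj.
    rewrite -!surjective_pairing => pq.
    by have [->] := uniq_map_inj Lu cL dL pq.
  - move=> _ [i [b ->]].
    have : (i, b) \in [seq frame_face p.2 | p <- L].
      by move: i; apply: forall_I3; apply: (allP (allP Lf _ _)); case: (b).
    case/mapP=> -[c p] cL /= pE; exists (cell a c).
      by exists c => //; rewrite /= -cellsL; apply/mapP; exists (c, p).
    by rewrite (cell_image _ _ cL) -pE.
have [fun_ _ surj] := bij.
split=> //.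
- by rewrite region_squares -[s in region a s]cellsL; exact: glue_continuous.
- apply/seteqP; split.
    move=> _ [x [S SU Sx] <-]; exists ((h \o glue L) @` S); first exact: fun_.
    by exists x.
  move=> y [F /surj[S SU <-] [x Sx <-]]; exists x => //; by exists S.
- move=> _ [c /frame_of[p cL] <-] x y cx cy.
  rewrite /= (glueE Lp La cL cx) (glueE Lp La cL cy) hh //.
  case: p cL => [[v i] j] cL; apply: (@fold_map_isometric _ _ _ _ _ _ setT) => //.
  exact: (allP Lp _ cL).
Qed.

(** * The classes of unfoldings *)

Lemma card_seq (T : eqType) (x0 : T) (s : seq T) :
  uniq s -> ([set` s] #= `I_(size s))%card.
Proof.
move=> us; have -> : [set` s] = nth x0 s @` `I_(size s).
  apply/seteqP; split=> [x /= xs|_ [n /= ns <-]]; last exact: mem_nth.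
  by exists (index x s); rewrite /= ?index_mem ?nth_index.
apply: inj_card_eq => m n; rewrite !inE /= => ms ns E.
by apply/eqP; rewrite -(nth_uniq x0 ms ns us) E.
Qed.

Lemma net_unfolding t : t \in nets -> unfolding a h (squares a t).
Proof.
move=> /nets_realizable[t6 ut gt ft bt]; split.
- rewrite -t6; apply: card_eq_trans (card_seq (0, 0) ut).
  by apply: inj_card_eq => c d _ _; exact: cell_inj.
- by move=> _ [c _ <-]; exact: cell_square.
- exact: squares_joined.
- split; last exact: boundary_connected.
  by move=> _ _ [c ct <-] [d dt <-]; exact: grown_chain.
- by exists (h \o glue (net_frames t)); exact: squares_folding.
Qed.

Lemma congruent_refl (U : set (set plane)) : congruent U U.
Proof.
exists id => //; apply/seteqP; split=> [S US|_ [S US <-]]; last by rewrite image_id.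
by exists S; rewrite ?image_id.
Qed.

Lemma congruent_sym (U V : set (set plane)) : congruent U V -> congruent V U.
Proof.
move=> [g gi ->]; have [k [ki gK _]] := euclidean_isometry_inv gi.
exists k => //; apply/seteqP; split=> S.
  move=> US; exists (g @` S); first by exists S.
  exact: image_cancel.
by move=> [_ [T UT <-] <-]; rewrite image_cancel.
Qed.

Lemma congruent_trans (U V W : set (set plane)) :
  congruent U V -> congruent V W -> congruent U W.
Proof.
move=> [g gi ->] [k ki ->]; exists (k \o g); first exact: euclidean_isometry_comp.
apply/seteqP; split=> S.
  by move=> [_ [T UT <-] <-]; exists T => //; rewrite image_comp.
by move=> [T UT <-]; exists (g @` T); [exists T|rewrite image_comp].
Qed.

(** A congruence carries some lattice cell to a lattice cell, so it is a lattice
    symmetry by [isometry_cell]. *)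
Lemma congruent_embeds s t :
  s != [::] -> congruent (squares a s) (squares a t) -> embeds s t.
Proof.
case: s => // c s _ [g gi tE].
have gt d : d \in c :: s -> exists2 e, e \in t & cell a e = g @` cell a d.
  move=> ds; have : squares a t (g @` cell a d).
    by rewrite tE; exists (cell a d) => //; exists d.
  by move=> [e et eE]; exists e.
have [e _ eE] := gt c (mem_head _ _).
have [|f _ fE] := isometry_cell a0 gi (c := c) (c' := e); first by rewrite eE.
apply: (embeds_intro (f := f)) => // d /gt[e' e't].
rewrite (_ : g = sym_pt a f); last exact/funext.
by rewrite sym_pt_image => /(cell_inj a0) <-.
Qed.

Definition net_class t := [set V | unfolding a h V /\ congruent (squares a t) V].

Lemma unfolding_classesE : unfolding_classes a h = [set net_class t | t in [set` nets]].
Proof.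
apply/seteqP; split=> C [].
  move=> U Uu <-; have [t tn tU] := unfolding_congruent_net a0 hh Uu.
  exists t => //; apply/seteqP; split=> V [Vu UV]; split=> //.
    exact: congruent_trans (congruent_sym tU) UV.
  exact: congruent_trans tU UV.
move=> t tn <-; exists (squares a t) => //; exact: net_unfolding.
Qed.

Lemma net_class_inj : {in [set` nets] &, injective net_class}.
Proof.
move=> s t /set_mem/= sn /set_mem/= tn st; apply: nets_distinct => //.
apply: congruent_embeds.
  by have [] := nets_realizable sn; case: (s).
have : net_class t (squares a t).
  split; [exact: net_unfolding|exact: congruent_refl].
by rewrite -st => -[].
Qed.

End Folding.

Theorem theorem10 (R : realType) (a : R) (ha : 0 < a)
  (h : 'rV[R]_3 -> 'rV[R]_3) (hh : euclidean_isometry h) :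
  (unfolding_classes a h #= `I_11)%card.
Proof.
rewrite unfolding_classesE //.
apply: card_eq_trans (inj_card_eq (net_class_inj ha hh)) _.
by have := @card_seq _ [::] nets (isT : uniq nets).
Qed.
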